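(* There is an explicit construction of an infinite sequence of triples of partitions $\lambda,\mu,\nu\vdash n$ (with $n\to\infty$) such that $g(\lambda,\mu,\nu)=\exp\Omega(n^{2/3})$, i.e. $g(\lambda,\mu,\nu)\ge e^{c\,n^{2/3}}$ for some constant $c>0$.
   Context: The Kronecker coefficient is $g(\lambda,\mu,\nu)=\frac{1}{n!}\sum_{\sigma\in S_n}\chi^\lambda(\sigma)\chi^\mu(\sigma)\chi^\nu(\sigma)$, with $\chi^\lambda$ the irreducible $S_n$-character indexed by $\lambda$. ''Explicit construction'' means the triples are given by a deterministic combinatorial recipe (not merely shown to exist by counting). *)

(* Defs.v *)
From mathcomp Require Import all_boot all_order all_algebra all_fingroup.
From mathcomp Require Import all_solvable all_field all_character.

Set Implicit Arguments.
Unset Strict Implicit.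
Unset Printing Implicit Defensive.

Import GRing.Theory.
Local Open Scope ring_scope.

Definition is_partition (n : nat) (sh : seq nat) : bool :=
  [&& sorted geq sh, 0%N \notin sh & sumn sh == n].

(* The Young diagram of sh is filled with 0, ..., n-1 in row-reading order, so *)
(* that the entry i lies in row reshape_index sh i, column reshape_offset sh i. *)
Definition row_stab (n : nat) (sh : seq nat) : {set 'S_n} :=
  [set s : 'S_n |
    [forall i : 'I_n, reshape_index sh (s i) == reshape_index sh i]].

Definition col_stab (n : nat) (sh : seq nat) : {set 'S_n} :=
  [set s : 'S_n |
    [forall i : 'I_n, reshape_offset sh (s i) == reshape_offset sh i]].

(* The group algebra C[S_n] is the space of regular_repr: the permutation s is *)
(* the basis row vector of index gring_index s, and S_n acts by right          *)
(* multiplication.                                                             *)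
Definition young_symmetrizer (n : nat) (sh : seq nat) :
    'rV[algC]_#|[set: 'S_n]| :=
  \sum_(r in row_stab n sh) \sum_(c in col_stab n sh)
    (-1) ^+ odd_perm c *:
      delta_mx 0 (gring_index [set: 'S_n]%G (r * c)%g).

(* The Specht module: the right ideal of C[S_n] generated by the Young          *)
(* symmetrizer; the one-row shape gives the trivial representation.             *)
Definition specht_repr (n : nat) (sh : seq nat) :=
  submod_repr (cyclic_mx_module (regular_repr algC [set: 'S_n]%G)
                                (young_symmetrizer n sh)).

Definition chi (n : nat) (sh : seq nat) : 'CF([set: 'S_n]) :=
  cfRepr (specht_repr n sh).

Definition kronecker (n : nat) (lam mu nu : seq nat) : algC :=
  (n`!)%:R^-1 * \sum_(s : 'S_n) chi n lam s * chi n mu s * chi n nu s.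

(* Closed arithmetic formulas with bounded sums (variables are de Bruijn        *)
(* indices; RSum b e binds variable 0 of e). Comparisons and counting are       *)
(* definable, e.g. [a <= b] is 1 - (a - b). A fixed formula takes polynomially  *)
(* bounded values and is evaluated in time polynomial in the values of its      *)
(* variables.                                                                   *)
Inductive recipe : Type :=
  | RVar of nat
  | RConst of nat
  | RAdd of recipe & recipe
  | RSub of recipe & recipe
  | RMul of recipe & recipe
  | RSum of recipe & recipe.

Fixpoint reval (env : seq nat) (e : recipe) : nat :=
  match e with
  | RVar i => nth 0 env i
  | RConst m => m
  | RAdd a b => reval env a + reval env b
  | RSub a b => reval env a - reval env b
  | RMul a b => reval env a * reval env b
  | RSum b a => \sum_(j < reval env b) reval ((j : nat) :: env) a
  end%N.

(* One formula, independent of k, gives the i-th part of the k-th partition. If *)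
(* the k-th partition has size n k with n increasing, then k <= n k, so the     *)
(* partition is produced in time polynomial in its size.                        *)
Definition explicit_family (p : nat -> seq nat) : Prop :=
  exists e : recipe, forall k i : nat, nth 0%N (p k) i = reval [:: k; i] e.

(* Main.v *)
Require Import Defs.
From mathcomp Require Import all_boot all_order all_algebra all_fingroup.
From mathcomp Require Import all_solvable all_field all_character.
From mathcomp Require Import reals sequences exp.
From mathcomp Require Import zify ring.
Import Order.TTheory GRing.Theory Num.Theory.
Local Open Scope ring_scope.
Set Implicit Arguments.
Unset Strict Implicit.
Unset Printing Implicit Defensive.

(** Let [f], [g], [h] colour the [n] points and let [M^f] be the permutation
    character on the colourings of the same content as [f]. Burnside counting
    shows that the multiplicity of the sign in [M^f M^g M^h] is the number of
    [n]-subsets of [N^3] whose marginals are the contents of [f], [g], [h].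
    If these marginals [lam], [mu], [nu] are partitions and the total of all
    coordinates is the least possible for [n] points of [N^3], then no such
    subset survives when one colouring is replaced by one of smaller sum, i.e.
    all constituents of [M^lam], [M^mu], [M^nu] that contribute are highest
    weight, hence Specht; so [g(lam, mu, nu')] is at least the number of
    subsets.

    A subset containing all points of weight [i + j + k < 3M] and contained in
    [i + j + k <= 3M] is minimal. The layer [i + j + k = 3M] is a triangular
    grid containing [M(M+1)/2] disjoint hexagons, and in each of them one may
    put either of the two alternating triangles of vertices, without changing
    any marginal. This gives [2^(M(M+1)/2)] subsets with [n = O(M^3)] points. *)

(** * Straightening of colourings *)

Section Colourings.

Variable n : nat.

Definition colouring := {ffun 'I_n -> nat}.
Implicit Types (f r c w : colouring) (s t x : 'S_n).

Definition stab f : {set 'S_n} := [set s : 'S_n | [forall p, f (s p) == f p]].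

Lemma stabP f s : reflect (forall p, f (s p) = f p) (s \in stab f).
Proof. by rewrite inE; apply: (iffP forallP) => H p; apply/eqP; rewrite H. Qed.

Lemma stab_group_set f : group_set (stab f).
Proof.
apply/group_setP; split; first by apply/stabP=> p; rewrite perm1.
by move=> s t /stabP Hs /stabP Ht; apply/stabP=> p; rewrite permM Ht Hs.
Qed.

Canonical stab_group f := Group (stab_group_set f).

Definition csum f : nat := \sum_p f p.

Definition recolour f (p : 'I_n) (i : nat) : colouring :=
  [ffun q => if q == p then i else f q].

Definition act f s : colouring := [ffun p => f (s p)].

Lemma csum_act f s : csum (act f s) = csum f.
Proof.
rewrite /csum [RHS](reindex_inj (@perm_inj _ s)).
by apply: eq_bigr => p _; rewrite ffunE.
Qed.

Lemma csum_recolour f p i : (csum (recolour f p i) + f p = csum f + i)%N.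
Proof.
rewrite /csum (bigD1 p) //= [in RHS](bigD1 p) //= ffunE eqxx.
have -> : (\sum_(q | q != p) recolour f p i q = \sum_(q | q != p) f q)%N.
  by apply: eq_bigr => q /negbTE qp; rewrite ffunE qp.
by rewrite addnC [in RHS]addnC addnCA.
Qed.

Definition mult f (i : nat) : nat := #|[set p | f p == i]|.

Lemma mult_act f s i : mult (act f s) i = mult f i.
Proof.
rewrite /mult -[RHS](card_imset _ (@perm_inj _ s^-1%g)); congr #|pred_of_set _|.
apply/setP=> p; rewrite !inE ffunE; apply/eqP/imsetP => [Hp|[q]].
  by exists (s p); rewrite ?inE ?Hp // permK.
by rewrite inE => /eqP <- ->; rewrite permKV.
Qed.

Definition agree f w : {set 'I_n} := [set p | f p == w p].

(** Take a disagreement [p] with [r p] minimal. If [w p < r p], every point of [r]-colour [w p]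
    would keep that colour in [w] and [p] would be one more, against equal multiplicities. *)
Lemma min_disagree r w : (forall i, mult w i = mult r i) -> w != r ->
  exists p, (r p < w p)%N /\ (forall q, r q < r p -> w q = r q)%N.
Proof.
move=> Hm nwr.
have [p0 Hp0] : exists p, w p != r p.
  apply/existsP; apply: contraNT nwr; rewrite negb_exists => /forallP H.
  by apply/eqP/ffunP=> p; have := H p; rewrite negbK => /eqP.
case: (@arg_minnP _ p0 (fun p => w p != r p) r Hp0) => p Hp Hmin; exists p.
have Hq q : (r q < r p)%N -> w q = r q.
  move=> lt; apply/eqP; apply: contraLR lt => H; rewrite -leqNgt; exact: Hmin.
split=> //; rewrite ltn_neqAle eq_sym Hp /= leqNgt.
apply/negP=> lt; have := Hm (w p); apply/eqP; rewrite gtn_eqF //.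
apply: proper_card; apply/properP; split.
  by apply/subsetP=> q; rewrite !inE => /eqP Hqw; rewrite Hq Hqw.
by exists p; rewrite inE // eq_sym.
Qed.

(* The relations satisfied by highest weight vectors: lowering a colour [j] to *)
(* [i] gives a colouring [w] of too small a sum, and the colourings obtained   *)
(* from [w] by raising one [i] back to [j] then add up to zero.                *)
Definition raising_rel r d (psi : colouring -> 'M[algC]_d) :=
  forall w i j, (csum w < csum r)%N ->
    \sum_(q | w q == i) psi (recolour w q j) = 0.

(** Induction on the number of disagreements. The raising relation at [w] with some [p] lowered to
    colour [r p] expresses a positive multiple of [psi w] through colourings closer to [r]. The
    scalar does not depend on [psi], which later gives one constant for all irreducible
    representations. *)
Lemma straightening r w : (forall i, mult w i = mult r i) -> csum w = csum r ->
  exists k : algC, forall d (psi : colouring -> 'M[algC]_d),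
    (forall v s, s \in stab r -> psi (act v s) = psi v) ->
    raising_rel r psi -> psi w = k *: psi r.
Proof.
move: {2}(n - #|agree w r|)%N (leqnn (n - #|agree w r|)%N) => m.
elim: m w => [|m IH] w Hagr Hm Hs; have [->|nwr] := eqVneq w r;
  try by exists 1 => d psi _ _; rewrite scale1r.
  case/eqP: nwr; apply/ffunP=> p.
  have : p \in agree w r; last by rewrite inE => /eqP.
  suff -> : agree w r = [set: 'I_n] by rewrite inE.
  apply/eqP; rewrite eqEcard subsetT cardsT card_ord.
  by rewrite -subn_eq0; rewrite leqn0 in Hagr.
have [p [ltp Hmin]] := min_disagree Hm nwr.
set i := r p in ltp Hmin *; set j := w p in ltp *.
set w1 := recolour w p i.
have w1s : (csum w1 < csum r)%N.
  by have := csum_recolour w p i; rewrite -/w1 -/j Hs; move: ltp; lia.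
pose inrow q := r q == i.
have Hstep q : w1 q == i -> ~~ inrow q -> exists k : algC,
    forall d (psi : colouring -> 'M[algC]_d),
    (forall v s, s \in stab r -> psi (act v s) = psi v) ->
    raising_rel r psi -> psi (recolour w1 q j) = k *: psi r.
  move=> wq rq; have qp : q != p by apply: contraNneq rq => ->; apply/eqP.
  have wqi : w q = i by move: wq; rewrite ffunE (negbTE qp) => /eqP.
  have E : recolour w1 q j = act w (tperm p q).
    apply/ffunP=> z; rewrite !ffunE.
    by case: tpermP => [->|->|/eqP/negbTE zp /eqP/negbTE zq];
       rewrite ?eqxx ?zp ?zq // eq_sym (negbTE qp).
  apply: IH.
  (* Exchanging the colours of [p] and [q] corrects [p] and cannot spoil [q], which has colour [i]
     in [w] but not in [r]. *)
  - have : agree w r \proper agree (recolour w1 q j) r.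
      apply/properP; split.
        apply/subsetP=> z; rewrite !inE !ffunE => /eqP Hz.
        have [zq|_] := eqVneq z q.
          by case/negP: rq; rewrite /inrow -zq -Hz zq wqi.
        by have [->|_] := eqVneq z p; apply/eqP.
      exists p; rewrite !inE ?ffunE ?eqxx.
        by rewrite [p == q]eq_sym (negbTE qp) ?ffunE ?eqxx.
      by rewrite gtn_eqF.
    move/proper_card; move: Hagr.
    have := subset_leq_card (subsetT (agree (recolour w1 q j) r)).
    by rewrite cardsT card_ord; lia.
  - by move=> l; rewrite E mult_act.
  - by rewrite E csum_act.
have [k Hk] : exists k : 'I_n -> algC, forall q, w1 q == i -> ~~ inrow q ->
    forall d (psi : colouring -> 'M[algC]_d),
    (forall v s, s \in stab r -> psi (act v s) = psi v) ->
    raising_rel r psi -> psi (recolour w1 q j) = k q *: psi r.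
  apply: (@fin_all_exists _ _ (fun q kq => w1 q == i -> ~~ inrow q ->
    forall d (psi : colouring -> 'M[algC]_d),
    (forall v s, s \in stab r -> psi (act v s) = psi v) ->
    raising_rel r psi -> psi (recolour w1 q j) = kq *: psi r)) => q.
  have [wq|_] := boolP (w1 q == i); last by exists 0.
  have [|rq] := boolP (inrow q); first by exists 0.
  by have [kq Hkq] := Hstep q wq rq; exists kq.
(* The [N] terms with [q] in the row of [p] differ from [w] by a transposition in [stab r], so each
   equals [psi w]; [q = p] is one of them. *)
pose N := #|[pred q | (w1 q == i) && inrow q]|.
have Npos : (0 < N)%N.
  by apply/card_gt0P; exists p; rewrite inE /= /inrow ffunE !eqxx.
exists (- N%:R^-1 * \sum_(q | (w1 q == i) && ~~ inrow q) k q) => d psi inv rel.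
have := rel w1 i j w1s; rewrite (bigID inrow) /=.
rewrite (eq_bigr (fun=> psi w)) => [|q /andP[wq rq]].
  rewrite sumr_const -/N.
  rewrite (eq_bigr (fun q => k q *: psi r)) => [|q /andP[wq rq]]; last exact: Hk.
  rewrite -scaler_suml => /eqP; rewrite addr_eq0 => /eqP E.
  have N0 : (N%:R : algC) != 0 by rewrite pnatr_eq0 -lt0n.
  rewrite mulNr scaleNr -scalerA -scalerN -E -scaler_nat scalerA mulVf //.
  by rewrite scale1r.
have -> : recolour w1 q j = act w (tperm p q).
  apply/ffunP=> z; rewrite !ffunE; have [->|qp] := eqVneq q p.
    rewrite tperm1 perm1; by case: eqP => // ->.
  move: wq; rewrite ffunE (negbTE qp) => /eqP wqi.
  by case: tpermP => [->|->|/eqP/negbTE zp /eqP/negbTE zq];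
     rewrite ?eqxx ?zp ?zq // eq_sym (negbTE qp).
apply: inv; apply/stabP=> z.
by case: tpermP => // ->; rewrite (eqP rq).
Qed.

End Colourings.

(** * Symmetrizers and antisymmetrizers *)

Section Symmetrizers.

Variable n : nat.
Implicit Types (f r c w : colouring n) (s t x : 'S_n).

Lemma act_act f s t : act (act f t) s = act f (s * t)%g.
Proof. by apply/ffunP=> p; rewrite !ffunE permM. Qed.

Section Rho.

Variables (d : nat) (rho : 'S_n -> 'M[algC]_d).
Hypothesis rhoM : forall s t, rho (s * t)%g = rho s *m rho t.

Definition symm f : 'M[algC]_d := \sum_(s in stab f) rho s.
Definition asym f : 'M[algC]_d := \sum_(s in stab f) (-1) ^+ odd_perm s *: rho s.

Lemma mulmx_symm f s : s \in stab f -> rho s *m symm f = symm f.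
Proof.
move=> fs; rewrite /symm mulmx_sumr [RHS](reindex_inj (mulgI s)) /=.
by apply: eq_big => [t|t _]; rewrite ?groupMl ?rhoM.
Qed.

Lemma asym_mulmx f s : s \in stab f ->
  asym f *m rho s = (-1) ^+ odd_perm s *: asym f.
Proof.
move=> fs; rewrite /asym mulmx_suml [in RHS](reindex_inj (mulIg s)) /= scaler_sumr.
apply: eq_big => [t|t _]; rewrite ?groupMr // rhoM odd_permM signr_addb.
by rewrite scalerA [_ * (-1) ^+ s]mulrC signrMK scalemxAl.
Qed.

Lemma symm_symm f : symm f *m symm f = #|stab f|%:R *: symm f.
Proof.
rewrite {1}/symm mulmx_suml (eq_bigr (fun=> symm f)); last exact: mulmx_symm.
by rewrite sumr_const scaler_nat.
Qed.

Lemma asym_asym f : asym f *m asym f = #|stab f|%:R *: asym f.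
Proof.
rewrite {2}/asym mulmx_sumr (eq_bigr (fun=> asym f)) => [|s fs].
  by rewrite sumr_const scaler_nat.
by rewrite -scalemxAr asym_mulmx // scalerA -signr_addb addbb scale1r.
Qed.

(* The image of [w] under the equivariant map sending the colouring [r] to the *)
(* symmetrizer of [r].                                                         *)
Definition orbit_sum r w : 'M[algC]_d := \sum_(x | act w x == r) rho x.

Lemma orbit_sum_mulmx r w t : orbit_sum r w *m rho t = orbit_sum r (act w t^-1%g).
Proof.
rewrite /orbit_sum mulmx_suml (reindex_inj (mulIg t^-1%g)) /=.
by apply: eq_big => [x|x _]; rewrite ?act_act // -rhoM mulgKV.
Qed.

Lemma orbit_sum_self r : orbit_sum r r = symm r.
Proof.
apply: eq_bigl => x; rewrite inE; apply/eqP/forallP=> [/ffunP H p|H].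
  by rewrite -[X in _ == X]H ffunE.
by apply/ffunP=> p; rewrite ffunE; apply/eqP.
Qed.

Lemma act_recolour f s p i :
  act (recolour f p i) s = recolour (act f s) (s^-1%g p) i.
Proof.
apply/ffunP=> q; rewrite !ffunE; congr (if _ then _ else _).
by rewrite -(inj_eq (@perm_inj _ s^-1%g)) permK.
Qed.

Lemma act_stab f s : s \in stab f -> act f s = f.
Proof. by move/stabP=> H; apply/ffunP=> p; rewrite ffunE. Qed.

(** The sum over [q] is fixed by right multiplication by [stab w], so [symm w] multiplies it by the
    order of [stab w]; but [symm w] is zero. *)
Lemma raising_rel_orbit_sum r : (forall f, (csum f < csum r)%N -> symm f = 0) ->
  raising_rel r (fun w => orbit_sum r w *m symm r).
Proof.
move=> H w i j /H w0; rewrite -mulmx_suml.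
set Z := \sum_(q | _) _; suff -> : Z = 0 by rewrite mul0mx.
have Zt t : t \in stab w -> Z *m rho t = Z.
  move=> wt; rewrite /Z mulmx_suml [RHS](reindex_inj (@perm_inj _ t)) /=.
  apply: eq_big => [q|q _]; first by rewrite (stabP _ _ wt).
  by rewrite orbit_sum_mulmx act_recolour invgK act_stab ?groupV.
have : Z *m symm w = #|stab w|%:R *: Z.
  rewrite mulmx_sumr (eq_bigr (fun=> Z)); last exact: Zt.
  by rewrite sumr_const scaler_nat.
rewrite w0 mulmx0 => /esym/eqP; rewrite scaler_eq0 pnatr_eq0.
by rewrite (gtn_eqF (cardG_gt0 (stab_group w))) /= => /eqP.
Qed.

End Rho.

(** Each [symm r *m rho s *m symm r] is the image of a rearrangement of [r], which straightening
    reduces to a multiple of the image of [r] itself. *)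
Lemma symm_asym_symm r c : exists K : algC,
  forall d (rho : 'S_n -> 'M[algC]_d),
    (forall s t, rho (s * t)%g = rho s *m rho t) ->
    (forall f, (csum f < csum r)%N -> symm rho f = 0) ->
    symm rho r *m asym rho c *m symm rho r = K *: symm rho r.
Proof.
have /fin_all_exists[k Hk] s : exists k : algC,
    forall d (psi : colouring n -> 'M[algC]_d),
    (forall v s, s \in stab r -> psi (act v s) = psi v) ->
    raising_rel r psi -> psi (act r s^-1%g) = k *: psi r.
  by apply: straightening => [i|]; rewrite ?mult_act ?csum_act.
exists (\sum_(s in stab c) (-1) ^+ odd_perm s * k s * #|stab r|%:R) => d rho rhoM H.
rewrite -{1}orbit_sum_self [orbit_sum _ _ _ *m _]mulmx_sumr mulmx_suml scaler_suml.
apply: eq_bigr => s _; rewrite -scalemxAr -scalemxAl orbit_sum_mulmx //.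
have -> := Hk s d (fun w => orbit_sum rho r w *m symm rho r).
- by rewrite orbit_sum_self symm_symm // !scalerA.
- move=> v t rt; rewrite -[t in act v t]invgK -orbit_sum_mulmx // -mulmxA.
  by rewrite mulmx_symm ?groupV.
- exact: raising_rel_orbit_sum.
Qed.

(** [r] and [c] are the row and column of the entries of a bijective tableau: downward closure makes
    its set of cells a Young diagram, without choosing a partition. *)
Definition young r c :=
  injective (fun p => (r p, c p)) /\
  forall p i j, (i <= r p)%N -> (j <= c p)%N -> exists q, r q = i /\ c q = j.

Lemma young_sym r c : young r c -> young c r.
Proof.
case=> inj H; split=> [p q [cp rp]|p i j Hi Hj]; first by apply: inj; rewrite cp rp.
by have [q [? ?]] := H p j i Hj Hi; exists q.
Qed.

End Symmetrizers.

(** Compare the truncated deficits [m x - wt x]. Those of [Q] come only from points that lie in [P],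
    so their total is at most that of [P], while the caps [m] have equal totals. A cap depending on
    the point serves columns of varying length as well as layers. *)
Lemma sum_min_weight (T : eqType) (P Q : seq T) (wt m : T -> nat) :
  uniq P -> uniq Q -> (\sum_(x <- P) m x = \sum_(x <- Q) m x)%N ->
  {in P, forall x, (wt x <= m x)%N} ->
  {in Q, forall x, (wt x < m x)%N -> x \in P} ->
  (\sum_(x <- P) wt x <= \sum_(x <- Q) wt x)%N.
Proof.
move=> uP uQ Em HP HQ.
have EP : (\sum_(x <- P) (m x - wt x) + \sum_(x <- P) wt x = \sum_(x <- P) m x)%N.
  by rewrite -big_split; apply: eq_big_seq => x /HP /= /subnK.
have EQ : (\sum_(x <- Q) m x <= \sum_(x <- Q) (m x - wt x) + \sum_(x <- Q) wt x)%N.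
  by rewrite -big_split; apply: leq_sum => x _ /=; lia.
suff : (\sum_(x <- Q) (m x - wt x) <= \sum_(x <- P) (m x - wt x))%N by lia.
rewrite (bigID (mem P)) /= [X in (_ + X)%N]big1_seq => [|x /andP[xP xQ]]; last first.
  by apply/eqP; rewrite subn_eq0 leqNgt; apply: contra xP; apply: HQ.
rewrite addn0 -big_filter (perm_big [seq x <- P | x \in Q]) /=; last first.
  apply: uniq_perm; rewrite ?filter_uniq // => x.
  by rewrite !mem_filter andbC.
by rewrite big_filter [leqRHS](bigID (mem Q)) /= leq_addr.
Qed.

Section YoungPair.

Variable n : nat.
Implicit Types (f r c w : colouring n) (s t x : 'S_n).

(** Otherwise the cells [(c p, f p)] would be distinct and fill each column with as many cells as
    the diagram does, and filling the columns from row 0 onwards has the least total row number. *)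
Lemma young_collision r c f : young r c -> (csum f < csum r)%N ->
  exists p q, [/\ p != q, c p = c q & f p = f q].
Proof.
case=> inj dc lt.
have [/existsP[p /existsP[q /and3P[? /eqP? /eqP?]]]|H] :=
    boolP [exists p, exists q, [&& p != q, c p == c q & f p == f q]].
  by exists p, q.
have injf : injective (fun p => (c p, f p)).
  move=> p q [cpq fpq]; apply/eqP; apply: contraNT H => pq.
  by apply/existsP; exists p; apply/existsP; exists q; rewrite pq cpq fpq !eqxx.
pose len j := \max_(p | c p == j) (r p).+1.
have E (g : 'I_n -> nat * nat) F :
    (\sum_(z <- [seq g p | p <- enum 'I_n]) F z = \sum_p F (g p))%N.
  by rewrite big_map big_enum.
have := @sum_min_weight _ [seq (c p, r p) | p <- enum 'I_n]
  [seq (c p, f p) | p <- enum 'I_n] snd (fun z => len z.1).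
rewrite !E /= -/(csum r) -/(csum f) leqNgt lt => W; exfalso.
suff : ~~ true by []; apply: W => //.
- rewrite map_inj_uniq ?enum_uniq // => p q [cpq rpq]; apply: inj; congr pair => //.
- by rewrite map_inj_uniq ?enum_uniq.
- move=> _ /mapP[p _ ->] /=; apply: ltnW.
  by rewrite /len (bigD1 p) //= leq_maxl.
- move=> _ /mapP[p _ ->] /= ltf.
  have [p0 /andP[/eqP cp0 lep]] : exists p0, (c p0 == c p) && (f p <= r p0)%N.
    apply/existsP; apply: contraLR ltf; rewrite negb_exists -leqNgt => /forallP G.
    apply/bigmax_leqP => q cq; rewrite ltnNge; apply/negP => le.
    by have := G q; rewrite cq le.
  have [q [rq cq]] := dc p0 (f p) (c p0) lep (leqnn _).
  by apply/mapP; exists q; rewrite ?mem_enum // rq cq cp0.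
Qed.

(** The transposition of a collision between [c] and [act f x] lies in [stab c], and its conjugate
    by [x] lies in [stab f]. Moving it across [rho x] shows that the product is its own negative. *)
Lemma asym_symm_eq0 d (rho : 'S_n -> 'M[algC]_d) r c f x :
  (forall s t, rho (s * t)%g = rho s *m rho t) ->
  young r c -> (csum f < csum r)%N -> asym rho c *m rho x *m symm rho f = 0.
Proof.
move=> rhoM yrc lt.
have ltx : (csum (act f x) < csum r)%N by rewrite csum_act.
have [p [q [pq cpq]]] := young_collision yrc ltx; rewrite !ffunE => fpq.
have ct : tperm p q \in stab c.
  by apply/stabP=> z; case: tpermP => [->|->|_ _].
have ft : (tperm p q ^ x)%g \in stab f.
  rewrite tpermJ; apply/stabP=> z.
  by case: tpermP => [->|->|_ _].
set Z := _ *m _ *m _; suff /eqP : Z = - Z 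
  by rewrite -addr_eq0 -mulr2n -scaler_nat scaler_eq0 pnatr_eq0 => /eqP.
rewrite {1}/Z -(mulmx_symm rhoM ft) !mulmxA -(mulmxA (asym _ _)) -rhoM.
rewrite -conjgC rhoM mulmxA asym_mulmx // odd_tperm pq expr1 scaleN1r.
by rewrite !mulNmx.
Qed.

End YoungPair.

(** * The Young symmetrizer in the irreducible representations *)

(** A full-rank factorization [N = C *m R] turns the hypothesis into [R *m C = K%:M]. *)
Lemma mxtrace_quasi_idem d (N : 'M[algC]_d) K :
  N *m N = K *: N -> \tr N = K * (\rank N)%:R.
Proof.
move: (mulmx_base N) (col_base_full N) (row_base_free N).
move: (col_base N) (row_base N); move: (\rank N) => r C R <- fC fR NN.
have RC : R *m C = K%:M.
  move: (pinvmx C) (pinvmx R) (mulVpmx fC) (mulmxVp fR) => C' R' C'C RR'.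
  have := congr1 (fun A => C' *m A *m R') NN.
  rewrite -scalemxAr -scalemxAl !mulmxA C'C !mul1mx -!mulmxA RR'.
  by rewrite mulmx1 scalemx1.
by rewrite mxtrace_mulC RC mxtrace_scalar mulr_natr.
Qed.

(** [K^-1 *: L] is a projector onto [U] commuting with the action, so the trace on [U] is that of
    the action composed with it. *)
Lemma mxtrace_submod gT (G : {group gT}) m (rG : mx_representation algC G m)
    (L : 'M_m) K (U : 'M_m) (modU : mxmodule rG U) x :
  x \in G -> centgmx rG L -> L *m L = K *: L -> K != 0 -> (U :=: L)%MS ->
  \tr (submod_repr modU x) = K^-1 * \tr (L *m rG x).
Proof.
move=> Gx cL LL K0 UL.
set V : 'M_(\rank U, m) := val_submod 1%:M.
have VL : V *m L = K *: V.
  have /submxP[W ->] : (V <= L)%MS by rewrite -UL val_submodP.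
  by rewrite -mulmxA LL -scalemxAr.
have LIV : L *m (in_submod U 1%:M *m V) = L.
  by rewrite mulmxA -in_submodE -val_submodE in_submodK // UL.
rewrite /submod_repr /= /submod_mx in_submodE -/V.
have -> : V *m rG x = K^-1 *: (V *m rG x *m L).
  rewrite -mulmxA -(centgmxP cL) // mulmxA VL -scalemxAl scalerA mulVf //.
  by rewrite scale1r.
rewrite -scalemxAl mxtraceZ; congr (_ * _).
move: (in_submod U 1%:M) LIV => I; clearbody V => LIV.
by rewrite -!mulmxA mxtrace_mulC -!mulmxA LIV (centgmxP cL).
Qed.

Section YoungSymmetrizer.

Variable n : nat.
Local Notation G := [set: 'S_n]%G.
Implicit Types (f r c w : colouring n) (s t x : 'S_n).

Lemma repr_permM d (rG : mx_representation algC G d) s t :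
  rG (s * t)%g = rG s *m rG t.
Proof. by rewrite repr_mxM ?inE. Qed.

Lemma mxtrace_Chi (i : Iirr G) s : \tr ('Chi_i s) = 'chi_i s.
Proof. by rewrite -irrRepr cfunE inE. Qed.

Lemma symm_eq0 d (rho : 'S_n -> 'M[algC]_d) f :
  (forall s t, rho (s * t)%g = rho s *m rho t) ->
  \tr (symm rho f) = 0 -> symm rho f = 0.
Proof.
move=> rhoM; rewrite (mxtrace_quasi_idem (symm_symm rhoM f)) => /eqP.
rewrite mulf_eq0 !pnatr_eq0 (gtn_eqF (cardG_gt0 (stab_group f))) /=.
by rewrite mxrank_eq0 => /eqP.
Qed.

(** A nonzero row [u] of the Young symmetrizer generates the whole irreducible module, and
    [asym_symm_eq0] makes [symm f] kill every translate [u *m rG x]. *)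
Lemma irr_symm_eq0 d (rG : mx_representation algC G d) r c f :
  mx_irreducible rG -> young r c -> symm rG r *m asym rG c != 0 ->
  (csum f < csum r)%N -> symm rG f = 0.
Proof.
move=> /mx_irrP[_ irrG] yrc nz lt.
have [i nzi] : exists i, row i (symm rG r *m asym rG c) != 0.
  apply/existsP; apply: contraNT nz; rewrite negb_exists => /forallP H.
  by apply/eqP/row_matrixP=> i; rewrite row0; apply/eqP; rewrite -[_ == _]negbK H.
set u := row i _ in nzi.
have full : row_full (cyclic_mx rG u).
  by apply: irrG; rewrite ?cyclic_mx_module ?cyclic_mx_eq0.
apply/row_matrixP=> j; rewrite row0 rowE.
set v := delta_mx 0 j; have : (v <= cyclic_mx rG u)%MS.
  by rewrite (submx_trans (submx1 _)) // sub1mx.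
case/cyclic_mxP=> A /envelop_mxP[a ->] ->.
rewrite -mulmxA mulmx_suml mulmx_sumr big1 // => x _.
rewrite -scalemxAl -scalemxAr /u row_mul -mulmxA (mulmxA (asym _ _)).
by rewrite (asym_symm_eq0 _ (repr_permM rG) yrc lt) mulmx0 scaler0.
Qed.

Definition ysym d (rho : 'S_n -> 'M[algC]_d) r c := symm rho r *m asym rho c.

Lemma ysymE d (rho : 'S_n -> 'M[algC]_d) r c :
  (forall s t, rho (s * t)%g = rho s *m rho t) ->
  ysym rho r c =
  \sum_(a in stab r) \sum_(b in stab c) (-1) ^+ odd_perm b *: rho (a * b)%g.
Proof.
move=> rhoM; rewrite /ysym /symm mulmx_suml; apply: eq_bigr => a _.
by rewrite mulmx_sumr; apply: eq_bigr => b _; rewrite rhoM scalemxAr.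
Qed.

Lemma mxtrace_ysym r c (i : Iirr G) : \tr (ysym 'Chi_i r c) =
  \sum_(a in stab r) \sum_(b in stab c) (-1) ^+ odd_perm b * 'chi_i (a * b)%g.
Proof.
rewrite ysymE; last exact: repr_permM.
rewrite raddf_sum; apply: eq_bigr => a _ /=.
by rewrite raddf_sum; apply: eq_bigr => b _; rewrite /= mxtraceZ mxtrace_Chi.
Qed.

Lemma sum_irr_reg x : \sum_(i : Iirr G) 'chi_i 1%g * 'chi_i x =
  #|G|%:R *+ (x == 1%g) :> algC.
Proof.
rewrite -cfRegE cfReg_sum sum_cfunE; apply: eq_bigr => i _; by rewrite cfunE.
Qed.

Lemma young_stab_trivial r c a b : young r c -> a \in stab r -> b \in stab c ->
  (a * b == 1)%g = (a == 1%g) && (b == 1%g).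
Proof.
case=> inj _ ra cb; apply/eqP/andP => [ab1|[/eqP-> /eqP->]]; last by rewrite mulg1.
have E : a = b^-1%g by apply/eqP; rewrite eq_mulgV1 invgK ab1.
have a1 : a = 1%g.
  have ca : a \in stab c by rewrite E groupV.
  apply/permP=> p; rewrite perm1; apply: inj.
  by rewrite (stabP _ _ ra) (stabP _ _ ca).
by rewrite a1 eqxx; move: ab1; rewrite a1 mul1g => /eqP.
Qed.

(** The left side is the regular character evaluated at the Young symmetrizer, hence the group order
    times the coefficient of the identity, which is 1 because row and column stabilizers meet
    trivially. *)
Lemma mxtrace_ysym_reg r c : young r c ->
  \sum_(i : Iirr G) 'chi_i 1%g * \tr (ysym 'Chi_i r c) = #|G|%:R.
Proof.
move=> yrc; under eq_bigr => i _ do rewrite mxtrace_ysym mulr_sumr.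
rewrite exchange_big /= (bigD1 1%g) ?group1 //= [X in _ + X]big1 ?addr0.
  under eq_bigr => i _ do rewrite mulr_sumr.
  rewrite exchange_big /= (bigD1 1%g) ?group1 //= [X in _ + X]big1 ?addr0.
    under eq_bigr => i _ do rewrite odd_perm1 expr0 mul1r mulg1.
    by rewrite sum_irr_reg eqxx.
  move=> b /andP[cb nb]; under eq_bigr => i _ do rewrite mulrCA.
  by rewrite -mulr_sumr sum_irr_reg mul1g (negbTE nb) mulr0.
move=> a /andP[ra na]; under eq_bigr => i _ do rewrite mulr_sumr.
rewrite exchange_big big1 // => b cb; under eq_bigr => i _ do rewrite mulrCA.
rewrite -mulr_sumr sum_irr_reg (young_stab_trivial yrc ra cb) (negbTE na).
by rewrite mulr0.
Qed.

(** Where the Young symmetrizer is nonzero, [irr_symm_eq0] supplies the vanishing that straightening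
    needs, with the same [K] everywhere. If [K] were zero, all its traces would vanish,
    contradicting [mxtrace_ysym_reg]. *)
Lemma young_scalar r c : young r c -> exists K : algC, [/\ K != 0,
  forall d (rho : 'S_n -> 'M[algC]_d),
    (forall s t, rho (s * t)%g = rho s *m rho t) ->
    (forall f, (csum f < csum r)%N -> symm rho f = 0) ->
    symm rho r *m asym rho c *m symm rho r = K *: symm rho r &
  forall i : Iirr G, ysym 'Chi_i r c *m ysym 'Chi_i r c = K *: ysym 'Chi_i r c].
Proof.
move=> yrc; have [K HK] := symm_asym_symm r c; exists K.
have sq (i : Iirr G) : ysym 'Chi_i r c *m ysym 'Chi_i r c = K *: ysym 'Chi_i r c.
  have [z|nz] := eqVneq (ysym 'Chi_i r c) 0; first by rewrite z mulmx0 scaler0.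
  have H0 f : (csum f < csum r)%N -> symm 'Chi_i f = 0.
    exact: (irr_symm_eq0 (socle_irr _) yrc nz).
  by rewrite {2}/ysym mulmxA (HK _ _ (repr_permM _) H0) -scalemxAl.
split=> //; apply/eqP=> K0; have := mxtrace_ysym_reg yrc.
rewrite big1 => [/esym/eqP|i _]; first by rewrite pnatr_eq0 (gtn_eqF (cardG_gt0 G)).
by rewrite (mxtrace_quasi_idem (sq i)) K0 mul0r mulr0.
Qed.

(** * The Young symmetrizer as an element of the group algebra *)

Local Notation aG := (regular_repr algC G).

Lemma gring_mx_delta d (rG : mx_representation algC G d) s :
  gring_mx rG (delta_mx 0 (gring_index G s)) = rG s.
Proof. by rewrite /gring_mx /= -rowE rowK mxvecK gring_indexK ?inE. Qed.

Lemma gring_mxE d (rG : mx_representation algC G d) (z : 'rV_#|G|) :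
  gring_mx rG z = \sum_j z 0 j *: rG (enum_val j).
Proof.
rewrite {1}[z]row_sum_delta linear_sum /=; apply: eq_bigr => j _.
by rewrite linearZ /= -(gring_mx_delta rG) gring_valK.
Qed.

(** Fourier inversion: pairing with the regular character recovers each coefficient of [z] from its
    images in the irreducible representations. *)
Lemma gring_irr_eq0 (z : 'rV[algC]_#|G|) :
  (forall i : Iirr G, gring_mx 'Chi_i z = 0) -> z = 0.
Proof.
move=> H; apply/rowP=> k; rewrite mxE.
have : \sum_(i : Iirr G) 'chi_i 1%g *
    \tr (gring_mx 'Chi_i z *m 'Chi_i (enum_val k)^-1%g) = z 0 k * #|G|%:R.
  transitivity (\sum_(i : Iirr G) \sum_j z 0 j *
      ('chi_i 1%g * 'chi_i (enum_val j * (enum_val k)^-1)%g)).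
    apply: eq_bigr => i _; rewrite gring_mxE mulmx_suml raddf_sum /= mulr_sumr.
    apply: eq_bigr => j _; rewrite -scalemxAl mxtraceZ -repr_permM mxtrace_Chi.
    by rewrite mulrCA.
  rewrite exchange_big /= (bigD1 k) //= [X in _ + X]big1 ?addr0 => [|j jk].
    by rewrite -mulr_sumr sum_irr_reg mulgV eqxx.
  rewrite -mulr_sumr sum_irr_reg -eq_mulgV1 (inj_eq enum_val_inj) (negbTE jk).
  by rewrite mulr0.
rewrite big1 => [/esym/eqP|i _]; last by rewrite H mul0mx raddf0 mulr0.
by rewrite mulf_eq0 pnatr_eq0 (gtn_eqF (cardG_gt0 G)) orbF => /eqP.
Qed.

Definition ysym_row r c : 'rV[algC]_#|G| :=
  \sum_(a in stab r) \sum_(b in stab c)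
    (-1) ^+ odd_perm b *: delta_mx 0 (gring_index G (a * b)%g).

Lemma gring_mx_ysym d (rG : mx_representation algC G d) r c :
  gring_mx rG (ysym_row r c) = ysym rG r c.
Proof.
rewrite ysymE; last exact: repr_permM.
rewrite linear_sum; apply: eq_bigr => a _; rewrite /= linear_sum.
by apply: eq_bigr => b _; rewrite /= linearZ /= gring_mx_delta.
Qed.

Lemma ysym_row_sq r c K :
  (forall i : Iirr G, ysym 'Chi_i r c *m ysym 'Chi_i r c = K *: ysym 'Chi_i r c) ->
  ysym_row r c *m gring_mx aG (ysym_row r c) = K *: ysym_row r c.
Proof.
move=> H; apply/eqP; rewrite -subr_eq0; apply/eqP/gring_irr_eq0 => i.
by rewrite linearB linearZ /= gring_mxA !gring_mx_ysym H subrr.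
Qed.

End YoungSymmetrizer.

(** * Specht characters *)

Section SpechtCharacter.

Variable n : nat.
Local Notation G := [set: 'S_n]%G.
Local Notation aG := (regular_repr algC G).
Implicit Types (f r c w : colouring n) (s t x : 'S_n).

Definition ysym_char r c : 'CF(G) :=
  cfRepr (submod_repr (cyclic_mx_module aG (ysym_row r c))).

Lemma ysym_char_char r c : ysym_char r c \is a character.
Proof. exact: cfRepr_char. Qed.

(* The character is the trace of the right regular action composed with left *)
(* multiplication by the quasi-idempotent Young symmetrizer.                 *)
Lemma ysym_charE r c K s : K != 0 ->
  ysym_row r c *m gring_mx aG (ysym_row r c) = K *: ysym_row r c ->
  ysym_char r c s = K^-1 * \sum_(a in stab r) \sum_(b in stab c)
    (-1) ^+ odd_perm b * \sum_g (a * b * g * s == g)%g%:R.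
Proof.
set y := ysym_row r c => K0 yy.
pose L := lin1_mx (mulmx y \o gring_mx aG).
have Lv (v : 'rV_#|G|) : v *m L = y *m gring_mx aG v by rewrite mul_rV_lin1.
have cL : centgmx aG L.
  apply/centgmxP=> x Gx; apply/row_matrixP=> i; rewrite 2!row_mul.
  by rewrite [row i L]rowE [row i (aG x)]rowE !Lv gring_mxJ // mulmxA.
have LL : L *m L = K *: L.
  apply/row_matrixP=> i; rewrite row_mul rowE !Lv gring_mxA mulmxA yy.
  by rewrite -scalemxAl linearZ /= rowE Lv.
have UL : (cyclic_mx aG y :=: L)%MS.
  apply/eqmxP/andP; split.
    apply: cyclic_mx_sub.
      by apply/mxmoduleP=> x Gx; rewrite (centgmxP cL) // submxMl.
    apply/submxP; exists (delta_mx 0 (gring_index G 1%g)).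
    by rewrite Lv gring_mx_delta repr_mx1 mulmx1.
  apply/row_subP=> i; rewrite rowE Lv; apply/cyclic_mxP.
  by exists (gring_mx aG (delta_mx 0 i)); rewrite ?gring_mxP.
rewrite cfunE inE mulr1n (mxtrace_submod (cyclic_mx_module aG y) _ cL LL K0 UL) ?inE //.
congr (_ * _).
have -> : \tr (L *m aG s) = \sum_(g in G) (y *m aG (g * s)%g) 0 (gring_index G g).
  rewrite [RHS]big_enum_val /mxtrace; apply: eq_bigr => j _.
  rewrite repr_permM mulmxA -(gring_mx_delta aG (enum_val j)) gring_valK -Lv.
  by rewrite -mulmxA -rowE [RHS]mxE.
transitivity (\sum_(g in G) \sum_(a in stab r) \sum_(b in stab c)
    (-1) ^+ odd_perm b * (a * b * g * s == g)%g%:R : algC).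
  apply: eq_bigr => g _; rewrite mulmx_suml summxE; apply: eq_bigr => a _.
  rewrite mulmx_suml summxE; apply: eq_bigr => b _.
  rewrite -scalemxAl mxE -rowE rowK gring_indexK ?inE // mxE eqxx /=.
  by rewrite (can_in_eq (gring_indexK)) ?inE // eq_sym !mulgA.
rewrite exchange_big; apply: eq_bigr => a _.
rewrite exchange_big; apply: eq_bigr => b _.
by rewrite mulr_sumr; apply: eq_bigl => g; rewrite inE.
Qed.

Lemma cfdot_ysym_char r c K (i : Iirr G) : K != 0 ->
  ysym_row r c *m gring_mx aG (ysym_row r c) = K *: ysym_row r c ->
  '[ysym_char r c, 'chi_i] = K^-1 * \tr (ysym 'Chi_i r c).
Proof.
move=> K0 yy; rewrite cfdotE mxtrace_ysym.
have G0 : (#|G|%:R : algC) != 0 by rewrite pnatr_eq0 (gtn_eqF (cardG_gt0 G)).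
apply: (mulfI G0); rewrite mulrA mulfV // mul1r [RHS]mulrCA.
transitivity (K^-1 * (\sum_(s in G) \sum_(a in stab r) \sum_(b in stab c)
    \sum_g (-1) ^+ odd_perm b * (a * b * g * s == g)%g%:R * ('chi_i s)^*)).
  rewrite mulr_sumr; apply: eq_bigr => s _; rewrite (ysym_charE _ K0 yy) -mulrA.
  congr (_ * _); rewrite mulr_suml; apply: eq_bigr => a _.
  rewrite mulr_suml; apply: eq_bigr => b _.
  by rewrite mulr_sumr mulr_suml.
congr (_ * _); rewrite exchange_big mulr_sumr; apply: eq_bigr => a _ /=.
rewrite exchange_big mulr_sumr; apply: eq_bigr => b _ /=.
rewrite exchange_big /= (eq_bigr (fun=> (-1) ^+ odd_perm b * 'chi_i (a * b)%g)).
  by rewrite sumr_const cardsT mulr_natl.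
(* For given [a], [b], [g] a single [s] solves the equation, a conjugate of the inverse of [a * b],
   so every [g] contributes the same value. *)
move=> g _; rewrite (bigD1 (((a * b)^-1) ^ g)%g) ?inE //= big1 ?addr0.
  have -> : (a * b * g * (a * b)^-1 ^ g == g)%g.
    by rewrite /conjg !mulgA mulgK mulgV mul1g.
  by rewrite mulr1 cfunJ ?inE // irr_inv conjCK.
move=> s /andP[_ ns]; case: eqP => [E|_]; last by rewrite mulr0 mul0r.
case/eqP: ns; apply: (mulgI (a * b * g)%g).
by rewrite E /conjg !mulgA mulgK mulgV mul1g.
Qed.

End SpechtCharacter.

(** * Permutation characters *)

Lemma clear_denominators3 (F : fieldType) (a b c x y z e : F) :
  a != 0 -> b != 0 -> c != 0 ->
  a^-1 * x * (b^-1 * y) * (e * (c^-1 * z)) * (a * b * c) = x * y * (e * z).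
Proof. by move=> a0 b0 c0; field; rewrite a0 b0 c0. Qed.

Section PermutationCharacters.

Variable n : nat.
Local Notation G := [set: 'S_n]%G.
Implicit Types (f g h r c w : colouring n) (s t x y z : 'S_n).

(** Tensoring with the sign exchanges [symm] and [asym], so that results on rows apply to
    columns. *)
Definition twist d (rho : 'S_n -> 'M[algC]_d) s := (-1) ^+ odd_perm s *: rho s.

Lemma twistM d (rho : 'S_n -> 'M[algC]_d) :
  (forall s t, rho (s * t)%g = rho s *m rho t) ->
  forall s t, twist rho (s * t)%g = twist rho s *m twist rho t.
Proof.
move=> rhoM s t; rewrite /twist odd_permM signr_addb rhoM.
by rewrite -scalemxAl -scalemxAr scalerA.
Qed.

Lemma symm_twist d (rho : 'S_n -> 'M[algC]_d) f : symm (twist rho) f = asym rho f.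
Proof. by []. Qed.

Lemma asym_twist d (rho : 'S_n -> 'M[algC]_d) f : asym (twist rho) f = symm rho f.
Proof.
apply: eq_bigr => s _; by rewrite /twist scalerA -signr_addb addbb scale1r.
Qed.

Lemma sgn_repr_subproof :
  mx_repr G (fun s => ((-1) ^+ odd_perm s)%:M : 'M[algC]_1).
Proof.
split=> [|s t _ _]; first by rewrite odd_perm1.
by rewrite odd_permM signr_addb scalar_mxM.
Qed.

Definition sgn_char : 'CF(G) := cfRepr (MxRepresentation sgn_repr_subproof).

Lemma sgn_charE s : sgn_char s = (-1) ^+ odd_perm s.
Proof. by rewrite cfunE inE mxtrace_scalar. Qed.

Lemma mul_cfunE (phi psi : 'CF(G)) s : (phi * psi) s = phi s * psi s.
Proof. by rewrite cfunE. Qed.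

Definition perm_char f : 'CF(G) := 'Ind[G] (1 : 'CF(stab_group f)).
Definition sperm_char f : 'CF(G) := sgn_char * perm_char f.

Lemma perm_char_char f : perm_char f \is a character.
Proof. by rewrite cfInd_char ?rpred1. Qed.

Lemma sperm_char_char f : sperm_char f \is a character.
Proof. by rewrite rpredM ?perm_char_char ?cfRepr_char. Qed.

Lemma cfdot_ind1 (phi : 'CF(G)) f :
  '[phi, perm_char f] = #|stab f|%:R^-1 * \sum_(s in stab f) phi s.
Proof.
rewrite -cfdot_Res_l cfdotE; congr (_ * _); apply: eq_bigr => s fs.
by rewrite cfResE ?subsetT // cfun1E fs rmorph1 mulr1.
Qed.

Lemma cfdot_perm_char f (i : Iirr G) :
  '[perm_char f, 'chi_i] = #|stab f|%:R^-1 * \tr (symm 'Chi_i f).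
Proof.
rewrite cfdotC_char ?irr_char ?perm_char_char // cfdot_ind1; congr (_ * _).
by rewrite raddf_sum; apply: eq_bigr => s _; rewrite /= mxtrace_Chi.
Qed.

Lemma cfdot_sperm_char f (i : Iirr G) :
  '[sperm_char f, 'chi_i] = #|stab f|%:R^-1 * \tr (asym 'Chi_i f).
Proof.
rewrite cfdotC_char ?irr_char ?sperm_char_char //.
have -> : '['chi_i, sperm_char f] = '[sgn_char * 'chi_i, perm_char f].
  rewrite !cfdotE; congr (_ * _); apply: eq_bigr => s _.
  by rewrite !mul_cfunE sgn_charE rmorphM /= rmorph_sign mulrCA mulrA.
rewrite cfdot_ind1; congr (_ * _); rewrite raddf_sum; apply: eq_bigr => s _.
by rewrite /= mxtraceZ mxtrace_Chi mul_cfunE sgn_charE.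
Qed.

Lemma stab_act f s x : ((s ^ x)%g \in stab f) = (s \in stab (act f x)).
Proof.
apply/stabP/stabP => H p.
  by rewrite !ffunE; have := H (x p); rewrite permJ.
by have := H (x^-1%g p); rewrite !ffunE permKV /conjg !permM.
Qed.

Lemma perm_charE f s :
  perm_char f s = #|stab f|%:R^-1 * \sum_x (s \in stab (act f x))%:R.
Proof.
rewrite cfIndE ?subsetT //; congr (_ * _).
by apply: eq_big => [x|x _]; [rewrite inE | rewrite cfun1E stab_act].
Qed.

(** If [W p = W q] with [p != q], multiplication by the transposition is a sign-reversing involution
    of the stabilizer; if [W] is injective, only the identity is left. *)
Lemma sum_sgn_stab (T : eqType) (W : 'I_n -> T) :
  \sum_(s : 'S_n | [forall p, W (s p) == W p]) (-1) ^+ odd_perm s =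
  (injectiveb W)%:R :> algC.
Proof.
have [injW|] := boolP (injectiveb W).
  rewrite (bigD1 1%g) /=; last by apply/forallP=> p; rewrite perm1.
  rewrite odd_perm1 big1 ?addr0 // => s /andP[/forallP H /eqP[]].
  by apply/permP=> p; rewrite perm1; apply: (injectiveP _ injW); apply/eqP.
case/injectivePn=> p [q pq Wpq].
set S := \sum_(s | _) _; suff /eqP : S = - S.
  by rewrite -addr_eq0 -mulr2n mulrn_eq0 /= => /eqP.
rewrite {1}/S (reindex_inj (mulgI (tperm p q))) -sumrN.
have Wt (z : 'I_n) : W (tperm p q z) = W z by case: tpermP => // ->.
apply: eq_big => [s|s _]; last by rewrite odd_permM odd_tperm pq signr_addb mulN1r.
apply/forallP/forallP => H z; last by rewrite permM (eqP (H _)) Wt.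
by have := H (tperm p q z); rewrite permM tpermK Wt.
Qed.

(** Triples of rearrangements stand for labelled point sets: a set of [n] points with these
    marginals has n! labellings, each given by as many triples as the product of the orders of the
    three stabilizers. *)
Definition inj_triples f g h : {set 'S_n * 'S_n * 'S_n} :=
  [set w : 'S_n * 'S_n * 'S_n | injectiveb
    (fun p : 'I_n => (f (w.1.1 p), g (w.1.2 p), h (w.2 p)))].

(** Expanding the three induced characters leaves, for each triple of rearrangements, the signed sum
    over the common stabilizer of the three colourings, which [sum_sgn_stab] evaluates. *)
Lemma cfdot_inj_triples f g h :
  '[perm_char f * perm_char g * sperm_char h, 1] *
    (n`! * (#|stab f| * #|stab g| * #|stab h|))%:R = #|inj_triples f g h|%:R.
Proof.
have nz k : (#|stab k|%:R : algC) != 0.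
  by rewrite pnatr_eq0 (gtn_eqF (cardG_gt0 (stab_group k))).
have cG : #|G| = n`! by rewrite cardsT card_Sn.
have nG : (n`!%:R : algC) != 0 by rewrite -cG pnatr_eq0 (gtn_eqF (cardG_gt0 G)).
rewrite cfdotE cG !natrM mulrACA mulVf // mul1r.
transitivity (\sum_(w : 'S_n * 'S_n * 'S_n) \sum_s
   (s \in stab (act f w.1.1))%:R * (s \in stab (act g w.1.2))%:R *
   ((-1) ^+ odd_perm s * (s \in stab (act h w.2))%:R) : algC).
  rewrite [RHS]exchange_big mulr_suml; apply: eq_big => [s|s _]; first by rewrite inE.
  rewrite cfun1E inE rmorph1 mulr1 !mul_cfunE sgn_charE !perm_charE.
  rewrite -(pair_bigA _ (fun xy z => (s \in stab (act f xy.1))%:R *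
     (s \in stab (act g xy.2))%:R * ((-1) ^+ odd_perm s * (s \in stab (act h z))%:R))) /=.
  rewrite -(pair_bigA _ (fun x y => \sum_z (s \in stab (act f x))%:R *
     (s \in stab (act g y))%:R * ((-1) ^+ odd_perm s * (s \in stab (act h z))%:R))) /=.
  set F := \sum_x (s \in stab (act f x))%:R.
  set H := \sum_x (s \in stab (act g x))%:R.
  set K := \sum_x (s \in stab (act h x))%:R.
  transitivity (F * H * ((-1) ^+ odd_perm s * K)).
    exact: clear_denominators3.
  rewrite /F mulr_suml mulr_suml; apply: eq_bigr => x _.
  rewrite /H -mulrA mulr_suml mulr_sumr; apply: eq_bigr => y _.
  by rewrite /K mulr_sumr mulr_sumr mulr_sumr; apply: eq_bigr => z _; rewrite mulrA.
rewrite -sum1_card natr_sum [RHS]big_mkcond; apply: eq_bigr => w _.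
transitivity ((injectiveb (fun p => (f (w.1.1 p), g (w.1.2 p), h (w.2 p))))%:R : algC).
  rewrite -sum_sgn_stab [RHS]big_mkcond; apply: eq_bigr => s _.
  have -> : [forall p, (f (w.1.1 (s p)), g (w.1.2 (s p)), h (w.2 (s p)))
      == (f (w.1.1 p), g (w.1.2 p), h (w.2 p))] =
      [&& s \in stab (act f w.1.1), s \in stab (act g w.1.2) & s \in stab (act h w.2)].
    apply/forallP/and3P => [H|[/stabP H1 /stabP H2 /stabP H3] p].
      by split; apply/stabP=> p; have /eqP[] := H p; rewrite !ffunE.
    by have := H1 p; have := H2 p; have := H3 p; rewrite !ffunE => -> -> ->.
  by do 3!case: (s \in _); rewrite /= ?mulr1 ?mul1r ?mulr0 ?mul0r.
by rewrite inE; case: injectiveb.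
Qed.

End PermutationCharacters.

(** * Specht constituents of permutation characters *)

Section SpechtConstituents.

Variable n : nat.
Local Notation G := [set: 'S_n]%G.
Implicit Types (f g h r c w : colouring n) (s t x y z : 'S_n).

Lemma cfdot_mul3 (phi1 phi2 phi3 : 'CF(G)) :
  '[phi1 * phi2 * phi3, 1] = \sum_(w : Iirr G * Iirr G * Iirr G)
    '[phi1, 'chi_w.1.1] * '[phi2, 'chi_w.1.2] * '[phi3, 'chi_w.2] *
    '['chi_w.1.1 * 'chi_w.1.2 * 'chi_w.2, 1].
Proof.
rewrite {1}[phi1]cfun_sum_cfdot {1}[phi2]cfun_sum_cfdot {1}[phi3]cfun_sum_cfdot.
rewrite -(pair_bigA _ (fun v k => '[phi1, 'chi_v.1] * '[phi2, 'chi_v.2] *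
  '[phi3, 'chi_k] * '['chi_v.1 * 'chi_v.2 * 'chi_k, 1])) /=.
rewrite -(pair_bigA _ (fun i j => \sum_k '[phi1, 'chi_i] * '[phi2, 'chi_j] *
  '[phi3, 'chi_k] * '['chi_i * 'chi_j * 'chi_k, 1])) /=.
rewrite !mulr_suml cfdot_suml; apply: eq_bigr => i _.
rewrite [_ *: _ * _]mulr_sumr mulr_suml cfdot_suml; apply: eq_bigr => j _.
rewrite mulr_sumr cfdot_suml; apply: eq_bigr => k _.
rewrite -!(scalerAl, scalerAr) !cfdotZl.
move: '[phi1, 'chi_i] '[phi2, 'chi_j] '[phi3, 'chi_k] => a b e.
move: '['chi_i * 'chi_j * 'chi_k, 1] => X.
by rewrite !mulrA; congr (_ * X); rewrite [RHS]mulrC mulrA.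
Qed.

Lemma mul4_eq0 (F : fieldType) (a b c d : F) :
  (a * b * c * d == 0) = [|| a == 0, b == 0, c == 0 | d == 0].
Proof. by rewrite !mulf_eq0 -!orbA. Qed.

Lemma cross_ratio (F : fieldType) (k r s t : F) : k != 0 -> r != 0 ->
  r * t = k * s -> k^-1 * t = r^-1 * s.
Proof. by move=> k0 r0 E; rewrite -[t](mulKf r0) E mulrCA mulKf. Qed.

Lemma natr_stab_neq0 f : (#|stab f|%:R : algC) != 0.
Proof. by rewrite pnatr_eq0 (gtn_eqF (cardG_gt0 (stab_group f))). Qed.

(** Taking traces in [symm r *m asym c *m symm r = K *: symm r] and cycling one [symm r] round
    relates the traces of the Young symmetrizer and of [symm r]. *)
Lemma cfdot_ysym_perm r c (i : Iirr G) : young r c ->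
  (forall f, (csum f < csum r)%N -> '[perm_char f, 'chi_i] = 0) ->
  '[ysym_char r c, 'chi_i] = '[perm_char r, 'chi_i].
Proof.
move=> yrc H; have [K [K0 HK sq]] := young_scalar yrc.
rewrite (cfdot_ysym_char _ K0 (ysym_row_sq sq)) cfdot_perm_char.
have H0 f : (csum f < csum r)%N -> symm 'Chi_i f = 0.
  move/H/eqP; rewrite cfdot_perm_char mulf_eq0 invr_eq0.
  rewrite (negbTE (natr_stab_neq0 f)) /=.
  by move/eqP/symm_eq0; apply; apply: repr_permM.
have := congr1 mxtrace (HK _ _ (repr_permM 'Chi_i) H0).
rewrite mxtrace_mulC mulmxA symm_symm; last exact: repr_permM.
rewrite -scalemxAl !mxtraceZ.
exact/cross_ratio/natr_stab_neq0.
Qed.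

(** The argument for rows, applied to the transposed tableau and the sign twist, yields a constant
    [K'] for the antisymmetrizer, to be compared with [K]. *)
Lemma cfdot_ysym_sperm r c (i : Iirr G) : young r c ->
  (forall f, (csum f < csum c)%N -> '[sperm_char f, 'chi_i] = 0) ->
  '[ysym_char r c, 'chi_i] = '[sperm_char c, 'chi_i].
Proof.
move=> yrc H; have [K [K0 _ sq]] := young_scalar yrc.
have [K' [K'0 HK' _]] := young_scalar (young_sym yrc).
rewrite (cfdot_ysym_char _ K0 (ysym_row_sq sq)) cfdot_sperm_char.
have tM := twistM (repr_permM 'Chi_i).
have H0 f : (csum f < csum c)%N -> symm (twist 'Chi_i) f = 0.
  move/H/eqP; rewrite cfdot_sperm_char mulf_eq0 invr_eq0.
  rewrite (negbTE (natr_stab_neq0 f)) /=.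
  by move/eqP; apply: symm_eq0.
have E := HK' _ _ tM H0; rewrite asym_twist symm_twist in E.
have trE : #|stab c|%:R * \tr (ysym 'Chi_i r c) = K' * \tr (asym 'Chi_i c).
  rewrite -!mxtraceZ -E /ysym scalemxAr -asym_asym; last exact: repr_permM.
  by rewrite mulmxA mxtrace_mulC mulmxA.
have [y0|ny0] := eqVneq (ysym 'Chi_i r c) 0.
  move: trE; rewrite y0 !raddf0 !mulr0 => /esym/eqP; rewrite mulf_eq0.
  by rewrite (negbTE K'0) /= => /eqP->; rewrite mulr0.
(* Evaluating the square of a nonzero Young symmetrizer in two ways forces the constants to
   coincide. *)
suff EK : K = K' by move: trE; rewrite -EK; apply/cross_ratio/natr_stab_neq0.
apply/eqP; rewrite -subr_eq0; move: ny0; apply: contraNT => nK.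
have : (K - K') *: ysym 'Chi_i r c = 0.
  rewrite scalerBl -sq {1 2}/ysym -mulmxA [asym _ _ *m _]mulmxA E.
  by rewrite -scalemxAr subrr.
by move/eqP; rewrite scaler_eq0 (negbTE nK).
Qed.

Lemma cfdot_char_ge0 (phi psi : 'CF(G)) :
  phi \is a character -> psi \is a character -> 0 <= '[phi, psi].
Proof. by move=> Hp Hq; rewrite natr_ge0 // Cnat_cfdot_char. Qed.

Lemma cfdot_mul3_term_ge0 (phi1 phi2 phi3 : 'CF(G)) (w : Iirr G * Iirr G * Iirr G) :
  phi1 \is a character -> phi2 \is a character -> phi3 \is a character ->
  0 <= '[phi1, 'chi_w.1.1] * '[phi2, 'chi_w.1.2] * '[phi3, 'chi_w.2] *
    '['chi_w.1.1 * 'chi_w.1.2 * 'chi_w.2, 1].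
Proof.
move=> C1 C2 C3.
have := cfdot_char_ge0 C1 (irr_char w.1.1); have := cfdot_char_ge0 C2 (irr_char w.1.2).
have := cfdot_char_ge0 C3 (irr_char w.2).
have : 0 <= '['chi_w.1.1 * 'chi_w.1.2 * 'chi_w.2, 1].
  by apply: cfdot_char_ge0; rewrite ?rpredM ?irr_char ?rpred1.
move: '[phi1, 'chi_w.1.1] '[phi2, 'chi_w.1.2] '[phi3, 'chi_w.2] => a b e.
move: '['chi_w.1.1 * 'chi_w.1.2 * 'chi_w.2, 1] => X X0 e0 b0 a0.
by rewrite !mulr_ge0.
Qed.

Lemma cfdot_mul3_eq0 (phi1 phi2 phi3 : 'CF(G)) (w : Iirr G * Iirr G * Iirr G) :
  phi1 \is a character -> phi2 \is a character -> phi3 \is a character ->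
  '[phi1 * phi2 * phi3, 1] = 0 ->
  '[phi1, 'chi_w.1.1] * '[phi2, 'chi_w.1.2] * '[phi3, 'chi_w.2] *
    '['chi_w.1.1 * 'chi_w.1.2 * 'chi_w.2, 1] = 0.
Proof.
move=> C1 C2 C3; rewrite cfdot_mul3 => /eqP; rewrite psumr_eq0 => [/allP H|v _].
  by apply/eqP/H; rewrite mem_index_enum.
exact: cfdot_mul3_term_ge0.
Qed.

Lemma cfdot_inj_triples_eq0 f g h : inj_triples f g h = set0 ->
  '[perm_char f * perm_char g * sperm_char h, 1] = 0.
Proof.
move=> H; have := cfdot_inj_triples f g h; rewrite H cards0 => /eqP.
rewrite mulf_eq0 pnatr_eq0 => /orP[/eqP//|].
rewrite -leqn0 leqNgt !muln_gt0 fact_gt0 /=.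
by rewrite !(cardG_gt0 (stab_group _)).
Qed.

(* Minimality of the total weight kills the constituents that would come from *)
(* a colouring of smaller sum in any one of the three factors; what is left   *)
(* of the permutation characters are the Specht constituents.                 *)
Lemma kronecker_lower_bound r1 c1 r2 c2 r3 c3 :
  young r1 c1 -> young r2 c2 -> young r3 c3 ->
  (forall f g h, inj_triples f g h != set0 ->
    (csum r1 + csum r2 + csum c3 <= csum f + csum g + csum h)%N) ->
  '[perm_char r1 * perm_char r2 * sperm_char c3, 1] <=
  '[ysym_char r1 c1 * ysym_char r2 c2 * ysym_char r3 c3, 1].
Proof.
move=> y1 y2 y3 min; rewrite !cfdot_mul3; apply: ler_sum => w _.
set R := (X in _ <= X); set T := (X in X <= _).
have R0 : 0 <= R.
  by apply: cfdot_mul3_term_ge0; exact: ysym_char_char.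
have [T0|] := eqVneq T 0; first by rewrite T0.
rewrite /T mul4_eq0 !negb_or => /and4P[n1 n2 n3 n4].
rewrite /T /R.
(* A colouring [f] of smaller sum admits no injective triple, so its summands, nonnegative with sum
   zero, all vanish. The other three factors being nonzero, the constituent does not occur in
   [perm_char f]. *)
rewrite (cfdot_ysym_perm y1) => [|f lt]; last first.
  have := @cfdot_mul3_eq0 (perm_char f) (perm_char r2) (sperm_char c3) w
    (perm_char_char _) (perm_char_char _) (sperm_char_char _).
  rewrite cfdot_inj_triples_eq0 => [/(_ erefl)/eqP|].
    by rewrite mul4_eq0 (negbTE n2) (negbTE n3) (negbTE n4) !orbF => /eqP.
  by apply: contraTeq lt => /min; lia.
rewrite (cfdot_ysym_perm y2) => [|f lt]; last first.
  have := @cfdot_mul3_eq0 (perm_char r1) (perm_char f) (sperm_char c3) w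
    (perm_char_char _) (perm_char_char _) (sperm_char_char _).
  rewrite cfdot_inj_triples_eq0 => [/(_ erefl)/eqP|].
    by rewrite mul4_eq0 (negbTE n1) (negbTE n3) (negbTE n4) !orbF => /eqP.
  by apply: contraTeq lt => /min; lia.
rewrite (cfdot_ysym_sperm y3) => [//|f lt].
have := @cfdot_mul3_eq0 (perm_char r1) (perm_char r2) (sperm_char f) w
  (perm_char_char _) (perm_char_char _) (sperm_char_char _).
rewrite cfdot_inj_triples_eq0 => [/(_ erefl)/eqP|].
  by rewrite mul4_eq0 (negbTE n1) (negbTE n2) (negbTE n4) !orbF => /eqP.
by apply: contraTeq lt => /min; lia.
Qed.

End SpechtConstituents.

(** * Counting subsets with given marginals *)

Lemma reshape_index_cons a sh i : reshape_index (a :: sh) i =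
  if (i < a)%N then 0%N else (reshape_index sh (i - a)).+1.
Proof.
rewrite /reshape_index /= subn_eq0; case: ltnP => // le.
by rewrite subSn.
Qed.

Lemma reshape_offset_cons a sh i : reshape_offset (a :: sh) i =
  if (i < a)%N then i else reshape_offset sh (i - a).
Proof.
rewrite /reshape_offset reshape_index_cons; case: ltnP => le /=; first by rewrite subn0.
by rewrite subnDA.
Qed.

Lemma count_reshape_index sh i :
  count_mem i [seq reshape_index sh p | p <- iota 0 (sumn sh)] = nth 0%N sh i.
Proof.
elim: sh i => [|a sh IH] i; first by rewrite nth_nil.
have -> : [seq reshape_index (a :: sh) p | p <- iota 0 (sumn (a :: sh))] =
    nseq a 0%N ++ [seq k.+1 | k <- [seq reshape_index sh p | p <- iota 0 (sumn sh)]].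
  rewrite /= iotaD map_cat; congr cat.
    apply: (@eq_from_nth _ 0%N); rewrite size_map size_iota ?size_nseq // => j ja.
    by rewrite (nth_map 0%N) ?size_iota // nth_iota // reshape_index_cons ja nth_nseq ja.
  rewrite add0n -[X in iota X _]addn0 iotaDl -!map_comp; apply: eq_map => j /=.
  by rewrite reshape_index_cons ltnNge leq_addr /= addKn.
rewrite count_cat count_nseq count_map; case: i => [|i] /=.
  by rewrite mul1n (@eq_count _ _ pred0) ?count_pred0 ?addn0.
by rewrite mul0n add0n -IH; apply: eq_count => k /=.
Qed.

Lemma count_reshape_offset sh i :
  count_mem i [seq reshape_offset sh p | p <- iota 0 (sumn sh)] =
  count (fun a => i < a)%N sh.
Proof.
elim: sh => [|a sh IH] //.
have -> : [seq reshape_offset (a :: sh) p | p <- iota 0 (sumn (a :: sh))] =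
    iota 0 a ++ [seq reshape_offset sh p | p <- iota 0 (sumn sh)].
  rewrite /= iotaD map_cat; congr cat.
    apply: (@eq_from_nth _ 0%N); rewrite size_map size_iota // => j ja.
    by rewrite (nth_map 0%N) ?size_iota // nth_iota // reshape_offset_cons ja.
  rewrite add0n -[X in iota X _]addn0 iotaDl -!map_comp; apply: eq_map => j /=.
  by rewrite reshape_offset_cons ltnNge leq_addr /= addKn.
by rewrite count_cat IH /= count_uniq_mem ?iota_uniq // mem_iota add0n.
Qed.

Section Shapes.

Variable n : nat.
Local Notation G := [set: 'S_n]%G.
Implicit Types sh : seq nat.

Definition row_col sh : colouring n := [ffun p : 'I_n => reshape_index sh p].
Definition col_col sh : colouring n := [ffun p : 'I_n => reshape_offset sh p].

Lemma row_stabE sh : row_stab n sh = stab (row_col sh).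
Proof.
by apply/setP=> s; rewrite !inE; apply: eq_forallb => p; rewrite !ffunE.
Qed.

Lemma col_stabE sh : col_stab n sh = stab (col_col sh).
Proof.
by apply/setP=> s; rewrite !inE; apply: eq_forallb => p; rewrite !ffunE.
Qed.

Lemma chiE sh : chi n sh = ysym_char (row_col sh) (col_col sh).
Proof.
rewrite /chi /specht_repr /ysym_char.
suff -> : young_symmetrizer n sh = ysym_row (row_col sh) (col_col sh) by [].
by rewrite /young_symmetrizer row_stabE col_stabE.
Qed.

Lemma young_shape sh : is_partition n sh -> young (row_col sh) (col_col sh).
Proof.
case/and3P=> srt n0 /eqP sz; split=> [p q|p i j].
  rewrite !ffunE => -[rpq cpq]; apply: val_inj => /=.
  by rewrite -(reshape_indexK sh p) -(reshape_indexK sh q) rpq cpq.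
rewrite !ffunE => ir jc.
have pn : (p < sumn sh)%N by rewrite sz.
have jlt : (j < nth 0 sh i)%N.
  apply: leq_ltn_trans jc _; apply: leq_trans (reshape_offsetP pn) _.
  have rs := reshape_indexP pn.
  have tr : transitive geq by move=> x y z /= h1 h2; apply: leq_trans h2 h1.
  apply: (sorted_leq_nth tr leqnn 0%N srt i _ _ rs ir).
  exact: leq_ltn_trans rs.
have ltn : (flatten_index sh i j < n)%N by rewrite -sz flatten_indexP.
by exists (Ordinal ltn); rewrite !ffunE /= flatten_indexKl // flatten_indexKr.
Qed.

Lemma kroneckerE lam mu nu : kronecker n lam mu nu =
  '[ysym_char (row_col lam) (col_col lam) * ysym_char (row_col mu) (col_col mu)
    * ysym_char (row_col nu) (col_col nu), 1].
Proof.
rewrite cfdotE cardsT card_Sn /kronecker !chiE; congr (_ * _).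
apply: eq_big => [s|s _]; first by rewrite inE.
by rewrite cfun1E inE rmorph1 mulr1 !mul_cfunE.
Qed.

Lemma kronecker_nat lam mu nu : exists g : nat, kronecker n lam mu nu = g%:R.
Proof.
rewrite kroneckerE; apply/natrP/Cnat_cfdot_char; last exact: rpred1.
by rewrite !rpredM ?ysym_char_char.
Qed.

(** * Families of point sets with prescribed marginals *)

Section Counting.

Variables (lam mu nu : seq nat) (m : nat) (I : finType) (A : {set I}).
Variable P : I -> seq (nat * nat * nat).
Hypotheses (plam : is_partition n lam) (pmu : is_partition n mu)
  (pnu : is_partition n nu).
Hypothesis uP : forall S, uniq (P S).
Hypothesis P1 : forall S, perm_eq [seq x.1.1 | x <- P S]
  [seq reshape_index lam p | p <- iota 0 n].
Hypothesis P2 : forall S, perm_eq [seq x.1.2 | x <- P S]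
  [seq reshape_index mu p | p <- iota 0 n].
Hypothesis P3 : forall S, perm_eq [seq x.2 | x <- P S]
  [seq reshape_offset nu p | p <- iota 0 n].
Hypothesis Pinj : {in A &, forall S S', P S =i P S' -> S = S'}.
Hypothesis A0 : (0 < #|A|)%N.
Definition weight (x : nat * nat * nat) : nat := (x.1.1 + x.1.2 + x.2)%N.
Hypothesis Pmax : forall S x, x \in P S -> (weight x <= m)%N.
Hypothesis Pmin : forall S x, (weight x < m)%N -> x \in P S.

Lemma size_points S : size (P S) = n.
Proof. by have /perm_size := P1 S; rewrite !size_map size_iota. Qed.

Lemma perm_colouring (s : seq nat) (h : nat -> nat) (f : colouring n) :
  (forall p : 'I_n, f p = h p) -> perm_eq s [seq h p | p <- iota 0 n] ->
  exists x : 'S_n, forall p : 'I_n, nth 0%N s p = f (x p).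
Proof.
move=> fh Hp; have sz : size s == n by rewrite (perm_size Hp) size_map size_iota.
have sz' : size [seq h p | p <- iota 0 n] == n by rewrite size_map size_iota.
have /tuple_permP[x Ex] : perm_eq (Tuple sz) (Tuple sz') by [].
exists x => p; rewrite fh -[s]/(tval (Tuple sz)) Ex.
rewrite (nth_map p) ?size_enum_ord // nth_ord_enum (tnth_nth 0%N) /=.
by rewrite (nth_map 0%N) ?size_iota // nth_iota.
Qed.

Definition point S (p : nat) := nth (0%N, 0%N, 0%N) (P S) p.

Lemma enum_points S : exists w : 'S_n * 'S_n * 'S_n, forall p : 'I_n,
  point S p = (row_col lam (w.1.1 p), row_col mu (w.1.2 p), col_col nu (w.2 p)).
Proof.
have [x Hx] : exists x : 'S_n, forall p : 'I_n,
    nth 0%N [seq x.1.1 | x <- P S] p = row_col lam (x p).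
  by apply: perm_colouring (P1 S) => p; rewrite ffunE.
have [y Hy] : exists x : 'S_n, forall p : 'I_n,
    nth 0%N [seq x.1.2 | x <- P S] p = row_col mu (x p).
  by apply: perm_colouring (P2 S) => p; rewrite ffunE.
have [z Hz] : exists x : 'S_n, forall p : 'I_n,
    nth 0%N [seq x.2 | x <- P S] p = col_col nu (x p).
  by apply: perm_colouring (P3 S) => p; rewrite ffunE.
exists (x, y, z) => p /=; rewrite -Hx -Hy -Hz.
have pn : (p < size (P S))%N by rewrite size_points.
by rewrite !(nth_map (0%N, 0%N, 0%N)) // /point; case: nth => -[].
Qed.

Lemma point_inj S (p q : 'I_n) : point S p = point S q -> p = q.
Proof.
by move/eqP; rewrite nth_uniq ?size_points // => /eqP/val_inj.
Qed.

Lemma mem_points S x : reflect (exists p : 'I_n, x = point S p) (x \in P S).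
Proof.
apply: (iffP (nthP (0%N, 0%N, 0%N))) => [[p]|[p ->]].
  by rewrite size_points => pn <-; exists (Ordinal pn).
by exists p; rewrite ?size_points.
Qed.

(** For each [S] fix rearrangements [w S] realizing an enumeration of [P S], then vary the labelling
    and the three stabilizer elements. *)
Lemma leq_inj_triples :
  (#|A| * (n`! * (#|stab (row_col lam)| * #|stab (row_col mu)| * #|stab (col_col nu)|))
   <= #|inj_triples (row_col lam) (row_col mu) (col_col nu)|)%N.
Proof.
set F := row_col lam; set H := row_col mu; set K := col_col nu.
have /fin_all_exists[w Hw] S := enum_points S.
pose D := setX A (setX [set: 'S_n] (setX (setX (stab F) (stab H)) (stab K))).
have <- : #|D| = (#|A| * (n`! * (#|stab F| * #|stab H| * #|stab K|)))%N.
  by rewrite !cardsX cardsT card_Sn.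
pose phi (t : I * ('S_n * ('S_n * 'S_n * 'S_n))) : 'S_n * 'S_n * 'S_n :=
  ((t.2.1 * (w t.1).1.1 * t.2.2.1.1)%g, (t.2.1 * (w t.1).1.2 * t.2.2.1.2)%g,
   (t.2.1 * (w t.1).2 * t.2.2.2)%g).
have Hphi t (p : 'I_n) : t \in D ->
    (F ((phi t).1.1 p), H ((phi t).1.2 p), K ((phi t).2 p)) = point t.1 (t.2.1 p).
  case: t => S [s [[a b] c]]; rewrite !in_setX in_setT /=.
  case/andP=> _ /andP[/andP[/stabP a1 /stabP a2] /stabP a3].
  by rewrite !permM a1 a2 a3 Hw.
(* The image recovers the point set and thus [S], then [s] because points do not repeat, and
   cancellation recovers the stabilizer elements. *)
have inj : {in D &, injective phi}.
  move=> [S [s [[a b] c]]] [S' [s' [[a' b'] c']]] Dt Dt' E.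
  have Es (p : 'I_n) : point S (s p) = point S' (s' p).
    by have := Hphi _ p Dt; rewrite E Hphi.
  have ES : S = S'.
    move: Dt Dt'; rewrite !inE /= => /andP[AS _] /andP[AS' _].
    apply: Pinj => // x; apply/mem_points/mem_points => -[p ->].
      by exists (s' (s^-1%g p)); rewrite -Es permKV.
    by exists (s (s'^-1%g p)); rewrite Es permKV.
  have Ess : s = s'.
    by apply/permP=> p; apply: (@point_inj S); rewrite Es ES.
  move: E; rewrite /phi /= ES Ess => -[/mulgI-> /mulgI-> /mulgI->] //.
rewrite -(card_in_imset inj); apply: subset_leq_card.
apply/subsetP=> _ /imsetP[t Dt ->]; rewrite inE; apply/injectiveP=> p q.
by rewrite /= !Hphi // => /point_inj/perm_inj.
Qed.

(** This is [sum_min_weight] with the constant cap [m]: any [P S] consists of all points of weight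
    below [m] and some of weight [m]. *)
Lemma inj_triples_weight (f g h : colouring n) : inj_triples f g h != set0 ->
  (csum (row_col lam) + csum (row_col mu) + csum (col_col nu)
   <= csum f + csum g + csum h)%N.
Proof.
case/set0Pn=> [[[x y] z]]; rewrite inE /= => /injectiveP injW.
have [S _] := card_gt0P A0; have [w Hw] := enum_points S.
rewrite -(csum_act _ w.1.1) -(csum_act (row_col mu) w.1.2) -(csum_act (col_col nu) w.2).
rewrite -(csum_act f x) -(csum_act g y) -(csum_act h z) /csum -!big_split /=.
pose Q := [seq (f (x p), g (y p), h (z p)) | p <- enum 'I_n].
have EQ : (\sum_(v <- Q) weight v =
    \sum_p (act f x p + act g y p + act h z p))%N.
  by rewrite /Q big_map big_enum /=; apply: eq_bigr => p _; rewrite !ffunE.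
have EP : (\sum_(v <- P S) weight v =
    \sum_p (act (row_col lam) w.1.1 p + act (row_col mu) w.1.2 p + act (col_col nu) w.2 p))%N.
  rewrite (big_nth (0%N, 0%N, 0%N)) size_points big_mkord; apply: eq_bigr => p _.
  by rewrite -/(point S p) Hw !ffunE.
rewrite -EQ -EP; apply: (@sum_min_weight _ _ _ _ (fun=> m)).
- exact: uP.
- by rewrite map_inj_uniq ?enum_uniq.
- by rewrite !big_const_seq !count_predT size_points size_map size_enum_ord.
- exact: Pmax.
- by move=> v _; apply: Pmin.
Qed.

Lemma kronecker_ge_card : #|A|%:R <= kronecker n lam mu nu.
Proof.
rewrite kroneckerE; apply: le_trans (kronecker_lower_bound (young_shape plam)
  (young_shape pmu) (young_shape pnu) inj_triples_weight).
set N := (n`! * (#|stab (row_col lam)| * #|stab (row_col mu)| * #|stab (col_col nu)|))%N.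
have N0 : (0 < N%:R :> algC).
  by rewrite ltr0n !muln_gt0 fact_gt0 /= !(cardG_gt0 (stab_group _)).
by rewrite -(ler_pM2r N0) cfdot_inj_triples -natrM ler_nat leq_inj_triples.
Qed.

End Counting.
End Shapes.

(** * Conjugate partitions *)

Local Open Scope nat_scope.

Lemma sum_ltn m c : \sum_(k < m) (k < c) = minn m c.
Proof.
elim: m => [|m IH]; first by rewrite big_ord0 min0n.
by rewrite big_ord_recr /= IH; lia.
Qed.

Section ConjugatePartition.

Variables (f : nat -> nat) (m : nat).
Hypothesis f_noninc : forall t, f t.+1 <= f t.
Hypothesis f_gt0 : forall t, (0 < f t) = (t < m).

Definition part := mkseq f m.
Definition conj_len j := \sum_(t < m) (j < f t).
Definition conj_part := mkseq conj_len (f 0).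

Lemma noninc_leq s t : s <= t -> f t <= f s.
Proof.
by move/subnK<-; elim: (t - s) => //= d; apply: leq_trans; rewrite addSn.
Qed.

(** Since [f] is nonincreasing, the rows longer than [j] form an initial segment. *)
Lemma conj_len_lt i j : (i < conj_len j) = (j < f i).
Proof.
have [lt|ge] := ltnP j (f i).
  have im : i < m by rewrite -f_gt0; apply: leq_ltn_trans lt.
  rewrite /conj_len -(big_mkord xpredT (fun t => (j < f t) : nat)).
  rewrite (big_cat_nat (n := i.+1)) //=; apply: leq_trans (leq_addr _ _).
  rewrite big_nat (eq_bigr (fun=> 1)) => [|t /andP[_ ti]].
    by rewrite -big_nat sum_nat_const_nat muln1 subn0.
  by have := noninc_leq (s := t) (t := i); case: ltnP => //; lia.
apply/negbTE; rewrite -leqNgt /conj_len.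
apply: leq_trans (_ : \sum_(t < m) (t < i) <= i).
  apply: leq_sum => t _; have := noninc_leq (s := i) (t := t).
  by case: (ltnP t i); case: ltnP => //; lia.
by rewrite sum_ltn geq_minr.
Qed.

Lemma nth_part t : nth 0 part t = f t.
Proof.
have [tm|mt] := ltnP t m; first by rewrite nth_mkseq.
rewrite nth_default ?size_mkseq //; have := f_gt0 t; rewrite [t < m]ltnNge mt.
by case: (f t).
Qed.

Lemma nth_conj_part j : nth 0 conj_part j = conj_len j.
Proof.
have [tm|mt] := ltnP j (f 0); first by rewrite nth_mkseq.
rewrite nth_default ?size_mkseq //; have := conj_len_lt 0 j; rewrite [j < f 0]ltnNge mt.
by case: (conj_len j).
Qed.

Lemma sumn_mkseq (h : nat -> nat) k : sumn (mkseq h k) = \sum_(t < k) h t.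
Proof. by rewrite sumnE big_map -(big_mkord xpredT) /index_iota subn0. Qed.

Lemma sorted_mkseq (h : nat -> nat) k :
  (forall t, h t.+1 <= h t) -> sorted geq (mkseq h k).
Proof.
move=> H; apply/(sortedP 0) => i; rewrite size_mkseq => ik.
by rewrite !nth_mkseq ?(ltnW ik) //; apply: H.
Qed.

Lemma part_partition : is_partition (\sum_(t < m) f t) part.
Proof.
rewrite /is_partition sorted_mkseq // sumn_mkseq eqxx andbT /=.
by apply/mapP=> -[t]; rewrite mem_iota add0n => /= tm f0; move: tm; rewrite -f_gt0 -f0.
Qed.

Lemma conj_part_partition : is_partition (\sum_(t < m) f t) conj_part.
Proof.
rewrite /is_partition sorted_mkseq ?sumn_mkseq /= => [|j]; last first.
  by apply: leq_sum => t _; case: ltnP => // h; rewrite (ltnW h).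
apply/andP; split.
  apply/mapP=> -[j]; rewrite mem_iota add0n => /= jf; have := conj_len_lt 0 j.
  by rewrite jf => h1 h2; rewrite -h2 in h1.
apply/eqP; rewrite exchange_big; apply: eq_bigr => t _ /=.
by rewrite sum_ltn; apply/minn_idPr/noninc_leq.
Qed.

End ConjugatePartition.

Local Close Scope nat_scope.

(** * Pyramids *)

Local Open Scope nat_scope.

Lemma sum_pick m t (g : nat -> nat) : \sum_(i < m) (i == t :> nat) * g i = (t < m) * g t.
Proof.
elim: m => [|m IH]; first by rewrite big_ord0.
rewrite big_ord_recr /= IH ltnS; have [->|ne] := eqVneq m t.
  by rewrite ltnn leqnn !mul0n mul1n.
by rewrite mul0n addn0 [t <= m]leq_eqVlt eq_sym (negbTE ne).
Qed.

Lemma count_sum (T : Type) (p : pred T) s : count p s = \sum_(x <- s) p x.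
Proof. by elim: s => [|x s IH]; rewrite ?big_nil ?big_cons //= IH. Qed.

Definition triple := (nat * nat * nat)%type.

Definition simplex m : seq triple :=
  [seq x <- [seq (p, k) | p <- [seq (i, j) | i <- iota 0 m, j <- iota 0 m],
                          k <- iota 0 m] | weight x < m].

Lemma mem_simplex m x : (x \in simplex m) = (weight x < m).
Proof.
rewrite mem_filter; case: ltnP => //= lt; case: x lt => [[i j] k].
rewrite /weight /= => lt; rewrite allpairs_f ?allpairs_f // mem_iota; lia.
Qed.

Lemma uniq_simplex m : uniq (simplex m).
Proof.
apply: filter_uniq; apply: allpairs_uniq; rewrite ?iota_uniq //.
- by apply: allpairs_uniq; rewrite ?iota_uniq // => -[? ?] [? ?] _ _.
- by move=> [? ?] [? ?] _ _.
Qed.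

Lemma sum_iota m (F : nat -> nat) : \sum_(i <- iota 0 m) F i = \sum_(i < m) F i.
Proof. by rewrite -(big_mkord xpredT) /index_iota subn0. Qed.

Lemma sum_simplex m (F : triple -> nat) : \sum_(x <- simplex m) F x =
  \sum_(i < m) \sum_(j < m) \sum_(k < m) (i + j + k < m) * F (i : nat, j : nat, k : nat).
Proof.
rewrite big_filter big_mkcond big_allpairs_dep big_allpairs_dep sum_iota.
apply: eq_bigr => i _; rewrite sum_iota; apply: eq_bigr => j _.
rewrite sum_iota; apply: eq_bigr => k _.
by rewrite /weight /=; case: ltnP; rewrite ?mul1n.
Qed.

Lemma sum_corner m t :
  \sum_(j < m) \sum_(k < m) (t + j + k < m) = \sum_(j < m) (m - t - j).
Proof.
apply: eq_bigr => j _; transitivity (\sum_(k < m) (k < m - t - j)).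
  by apply: eq_bigr => k _; congr nat_of_bool; lia.
by rewrite sum_ltn; lia.
Qed.

Lemma sum_corner_pick m t :
  \sum_(i < m) (i == t :> nat) * \sum_(j < m) \sum_(k < m) (i + j + k < m) =
  \sum_(j < m) (m - t - j).
Proof.
rewrite (sum_pick m t (fun i => \sum_(j < m) \sum_(k < m) (i + j + k < m))).
rewrite sum_corner; case: ltnP; rewrite ?mul1n // mul0n => le.
by rewrite big1 // => j _; lia.
Qed.

Lemma simplex_count1 m t :
  \sum_(x <- simplex m) (x.1.1 == t) = \sum_(j < m) (m - t - j).
Proof.
rewrite sum_simplex -sum_corner_pick; apply: eq_bigr => i _.
rewrite big_distrr; apply: eq_bigr => j _ /=.
by rewrite big_distrr; apply: eq_bigr => k _ /=; rewrite mulnC.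
Qed.

Lemma simplex_count2 m t :
  \sum_(x <- simplex m) (x.1.2 == t) = \sum_(j < m) (m - t - j).
Proof.
rewrite sum_simplex -sum_corner_pick exchange_big; apply: eq_bigr => i _.
rewrite big_distrr; apply: eq_bigr => j _ /=.
by rewrite big_distrr; apply: eq_bigr => k _ /=; rewrite mulnC [i + j]addnC.
Qed.

Lemma simplex_count3 m t :
  \sum_(x <- simplex m) (x.2 == t) = \sum_(j < m) (m - t - j).
Proof.
rewrite sum_simplex -sum_corner_pick.
under eq_bigr => i _ do rewrite exchange_big.
rewrite exchange_big; apply: eq_bigr => i _.
rewrite big_distrr; apply: eq_bigr => j _ /=.
rewrite big_distrr; apply: eq_bigr => k _ /=; rewrite mulnC.
by congr (_ * nat_of_bool _); lia.
Qed.

(** * The top layer and its hexagons *)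

Section Layer.

Variable M : nat.

Definition diag : seq (nat * nat) :=
  [seq p <- [seq (a, b) | a <- iota 0 M, b <- iota 0 M] | p.1 + p.2 < M].

Lemma mem_diag p : (p \in diag) = (p.1 + p.2 < M).
Proof.
rewrite mem_filter; case: ltnP => //= lt; case: p lt => [a b] /= lt.
by rewrite allpairs_f // mem_iota; lia.
Qed.

Lemma uniq_diag : uniq diag.
Proof.
by apply: filter_uniq; apply: allpairs_uniq; rewrite ?iota_uniq // => -[? ?] [? ?] _ _.
Qed.

(* The six neighbours of the centre [(3a+1, 3b+1, 3(M-a-b)-2)] of a hexagon in *)
(* the layer of weight [3M] split into two alternating triangles with the same *)
(* coordinates in every direction; [S] chooses one triangle for each hexagon.  *)
Definition corner (S : pred (nat * nat)) (x : (nat * nat) * nat) : triple :=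
  let v := (x.2 + 1 + ~~ S x.1) %% 3 in
  (3 * x.1.1 + x.2, 3 * x.1.2 + v, 3 * (M - x.1.1 - x.1.2) - (x.2 + v)).

Definition corners : seq ((nat * nat) * nat) := [seq (p, u) | p <- diag, u <- iota 0 3].

Lemma mem_corners x : (x \in corners) = (x.1.1 + x.1.2 < M) && (x.2 < 3).
Proof.
case: x => [p u]; apply/allpairsP/idP => [[[q w] [Hq Hw [-> ->]]]|/= /andP[Hp Hu]].
  by move: Hq; rewrite mem_diag /= => ->; case: w Hw => [|[|[|]]].
by exists (p, u); split; rewrite ?mem_diag //; case: u Hu => [|[|[|]]].
Qed.

Definition layer S := map (corner S) corners.

Lemma weight_corner S x : x \in corners -> weight (corner S x) = 3 * M.
Proof.
rewrite mem_corners => /andP[lt]; case: x lt => [[a b] u] /= lt.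
rewrite /corner /weight /=.
by case: u => [|[|[|//]]] _; case: (S _) => /=; lia.
Qed.

Lemma uniq_layer S : uniq (layer S).
Proof.
rewrite map_inj_in_uniq.
  apply: allpairs_uniq; rewrite ?uniq_diag ?iota_uniq //.
  by move=> [? ?] [? ?] _ _.
move=> [[a b] u] [[a' b'] u']; rewrite !mem_corners /= => /andP[_ lu] /andP[_ lu'].
rewrite /corner /= => -[E1 E2 _].
have [Ea Eu] : a = a' /\ u = u' by lia.
have : (u + 1 + ~~ S (a, b)) %% 3 < 3 by rewrite ltn_mod.
have : (u' + 1 + ~~ S (a', b')) %% 3 < 3 by rewrite ltn_mod.
move: E2; set v := _ %% 3; set v' := _ %% 3 => E2 lv lv'.
have -> : b = b' by lia.
by rewrite Ea Eu.
Qed.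

Lemma sum_layer S (F : triple -> nat) : \sum_(x <- layer S) F x =
  \sum_(a < M) \sum_(b < M) (a + b < M) *
    (F (corner S ((a : nat, b : nat), 0)) + F (corner S ((a : nat, b : nat), 1))
     + F (corner S ((a : nat, b : nat), 2))).
Proof.
rewrite big_map big_allpairs_dep big_filter big_mkcond big_allpairs_dep sum_iota.
apply: eq_bigr => a _; rewrite sum_iota; apply: eq_bigr => b _ /=.
case: ltnP => _; rewrite ?mul0n // mul1n.
by rewrite !big_cons big_nil addn0 addnA.
Qed.

(** The summand is the indicator of [t < 3 * (M - a)], so the value is [M - t %/ 3]; truncated
    subtraction is used because [recipe] has neither division nor comparison as a constructor. *)
Definition layer_len t := \sum_(a < M) (1 - (t.+1 - 3 * (M - a))).

Lemma layer_lenE t :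
  \sum_(a < M) \sum_(b < M) (a + b < M) * (b == t %/ 3 :> nat) = layer_len t.
Proof.
apply: eq_bigr => a _.
under eq_bigr => b _ do rewrite mulnC.
rewrite (sum_pick M (t %/ 3) (fun b => (a + b < M) : nat)).
by have := ltn_ord a; lia.
Qed.

Lemma layer_count1 S t : \sum_(x <- layer S) (x.1.1 == t) = layer_len t.
Proof.
rewrite sum_layer -layer_lenE exchange_big; apply: eq_bigr => a _.
apply: eq_bigr => b _ /=; rewrite [a + b]addnC; congr (_ * _).
by rewrite /corner /=; lia.
Qed.

Lemma layer_count2 S t : \sum_(x <- layer S) (x.1.2 == t) = layer_len t.
Proof.
rewrite sum_layer -layer_lenE; apply: eq_bigr => a _.
apply: eq_bigr => b _ /=; congr (_ * _).
by rewrite /corner /=; case: (S _) => /=; lia.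
Qed.

Lemma layer_count3 S t : \sum_(x <- layer S) (x.2 == t) = layer_len t.
Proof.
rewrite sum_layer; apply: eq_bigr => a _.
transitivity (\sum_(b < M) (b == M - 1 - a - t %/ 3 :> nat) * (a + t %/ 3 < M)).
  apply: eq_bigr => b _; rewrite /corner /=; case: ltnP => ab; last first.
    rewrite mul0n; move: (t %/ 3) => q; case: eqP => [E|_]; rewrite ?mul0n // mul1n.
    by case: ltnP => //; lia.
  rewrite mul1n; have [c Ec] : exists c, M = a + b + c.+1.
    by exists (M - a - b).-1; lia.
  have -> : M - a - b = c.+1 by lia.
  (* For either triangle the amount subtracted in [corner] takes the values 1, 2, 3 in some order,
     so the third coordinate runs through the block [3 * c], [3 * c + 1], [3 * c + 2]. *)
  transitivity (t %/ 3 == c : nat); first by case: (S _) => /=; lia.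
  move: (t %/ 3) => q; rewrite mulnb; congr nat_of_bool.
  by apply/eqP/andP => [->|[/eqP]]; [split; last lia; apply/eqP; lia | lia].
rewrite (sum_pick M _ (fun=> (a + t %/ 3 < M) : nat)).
by have := ltn_ord a; lia.
Qed.

Definition pyramid S := simplex (3 * M) ++ layer S.

Lemma uniq_pyramid S : uniq (pyramid S).
Proof.
rewrite cat_uniq uniq_simplex uniq_layer andbT; apply/hasPn => _ /mapP[x Hx ->].
by rewrite mem_simplex weight_corner // ltnn.
Qed.

Lemma pyramid_max S x : x \in pyramid S -> weight x <= 3 * M.
Proof.
rewrite mem_cat mem_simplex => /orP[/ltnW//|/mapP[y Hy ->]].
by rewrite weight_corner.
Qed.

Lemma pyramid_min S x : weight x < 3 * M -> x \in pyramid S.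
Proof. by move=> lt; rewrite mem_cat mem_simplex lt. Qed.

Definition lam_len t := \sum_(j < 3 * M) (3 * M - t - j) + layer_len t.

Lemma pyramid_count1 S t : count_mem t [seq x.1.1 | x <- pyramid S] = lam_len t.
Proof.
by rewrite count_map count_sum big_cat /= simplex_count1 layer_count1.
Qed.

Lemma pyramid_count2 S t : count_mem t [seq x.1.2 | x <- pyramid S] = lam_len t.
Proof.
by rewrite count_map count_sum big_cat /= simplex_count2 layer_count2.
Qed.

Lemma pyramid_count3 S t : count_mem t [seq x.2 | x <- pyramid S] = lam_len t.
Proof.
by rewrite count_map count_sum big_cat /= simplex_count3 layer_count3.
Qed.

Lemma lam_len_noninc t : lam_len t.+1 <= lam_len t.
Proof.
by rewrite /lam_len /layer_len leq_add //; apply: leq_sum => j _; lia.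
Qed.

Lemma lam_len_gt0 t : (0 < lam_len t) = (t < 3 * M).
Proof.
have [lt|ge] := ltnP t (3 * M).
  have m0 : 0 < 3 * M by lia.
  rewrite addn_gt0 (bigD1 (Ordinal m0)) //= subn0.
  by have : 0 < 3 * M - t by [lia]; case: (3 * M - t).
by rewrite /lam_len /layer_len !big1 // => j _; lia.
Qed.

Definition hexagons : {set 'I_M * 'I_M} := [set p : 'I_M * 'I_M | p.1 + p.2 < M].

Definition mem_nat (S : {set 'I_M * 'I_M}) : pred (nat * nat) :=
  fun ab => [exists p in S, (nat_of_ord p.1, nat_of_ord p.2) == ab].

Lemma mem_natE S (p : 'I_M * 'I_M) : mem_nat S (p.1 : nat, p.2 : nat) = (p \in S).
Proof.
apply/exists_inP/idP => [[[a b] Hq /eqP[/val_inj Ea /val_inj Eb]]|Hp]; last by exists p.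
by case: p Ea Eb => a' b' /= <- <-.
Qed.

(** The vertex [u = 2] detects the choice: its second coordinate is [3 * b] for a hexagon in [S] and
    [3 * b + 1] otherwise. *)
Lemma pyramid_inj : {in powerset hexagons &, forall S S',
  pyramid (mem_nat S) =i pyramid (mem_nat S') -> S = S'}.
Proof.
have sub (S S' : {set 'I_M * 'I_M}) : S \subset hexagons ->
    pyramid (mem_nat S) =i pyramid (mem_nat S') -> S \subset S'.
  move=> SD E; apply/subsetP=> -[a b] Sp.
  have abM : a + b < M by have := subsetP SD _ Sp; rewrite inE.
  have Hc : ((a : nat, b : nat), 2) \in corners by rewrite mem_corners /= abM.
  have : corner (mem_nat S) ((a : nat, b : nat), 2) \in pyramid (mem_nat S').
    by rewrite -E mem_cat map_f ?orbT.
  rewrite mem_cat mem_simplex weight_corner // ltnn /= => /mapP[[[a' b'] u]].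
  rewrite mem_corners /= => /andP[_ u3].
  rewrite /corner /= (mem_natE S (a, b)) Sp /= => -[E1 E2 _].
  have [Ea Eu] : a = a' :> nat /\ u = 2 by lia.
  move: E2; rewrite Eu -Ea; case S'E : (mem_nat S' (a : nat, b')) => /= E2; last by lia.
  have Eb : b = b' :> nat by lia.
  by rewrite -(mem_natE S' (a, b)) /= Eb.
move=> S S'; rewrite !inE => SD S'D E.
apply/eqP; rewrite eqEsubset (sub _ _ SD E) /=.
by apply: (sub _ _ S'D) => x; rewrite E.
Qed.

(** For any pair, its coordinate sum or that of the pair with both coordinates reversed is below
    [M], so the hexagons and their mirror images cover the square. *)
Lemma card_hexagons : M ^ 2 <= 2 * #|hexagons|.
Proof.
have -> : #|hexagons| = \sum_(a < M) \sum_(b < M) (a + b < M).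
  rewrite pair_bigA -sum1_card big_mkcond; apply: eq_bigr => p _ /=.
  by rewrite inE; case: ltnP.
rewrite mul2n -addnn [X in _ <= _ + X](reindex_inj rev_ord_inj) -big_split /=.
apply: leq_trans (_ : \sum_(a < M) M <= _); first by rewrite sum_nat_const card_ord.
apply: leq_sum => a _; rewrite [X in _ <= _ + X](reindex_inj rev_ord_inj) -big_split /=.
apply: leq_trans (_ : \sum_(b < M) 1 <= _); first by rewrite sum1_card card_ord.
by apply: leq_sum => b _; have := ltn_ord a; have := ltn_ord b; lia.
Qed.

End Layer.

Local Close Scope nat_scope.

(** * The family of triples *)

Definition kron_size k : nat := (\sum_(t < 3 * k) lam_len k t)%N.
Definition lam_part k := part (lam_len k) (3 * k).
(** Conjugation makes [lam_len k] the column lengths of the third shape, whose colouring by columns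
    carries the sign. *)
Definition nu_part k := conj_part (lam_len k) (3 * k).

Lemma lam_part_partition k : is_partition (kron_size k) (lam_part k).
Proof. exact: part_partition (lam_len_noninc k) (lam_len_gt0 k). Qed.

Lemma nu_part_partition k : is_partition (kron_size k) (nu_part k).
Proof. exact: conj_part_partition (lam_len_noninc k) (lam_len_gt0 k). Qed.

Lemma sumn_partition n sh : is_partition n sh -> sumn sh = n.
Proof. by case/and3P=> _ _ /eqP. Qed.

Lemma perm_eq_count (T : eqType) (s t : seq T) :
  (forall x, count_mem x s = count_mem x t) -> perm_eq s t.
Proof. by move=> H; apply/allP=> x _ /=; apply/eqP. Qed.

Lemma perm_rows k s : (forall t, count_mem t s = lam_len k t) ->
  perm_eq s [seq reshape_index (lam_part k) p | p <- iota 0 (kron_size k)].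
Proof.
move=> H; apply: perm_eq_count => t; rewrite H.
rewrite -(sumn_partition (lam_part_partition k)) count_reshape_index.
by rewrite (nth_part (lam_len_gt0 k)).
Qed.

Lemma perm_cols k s : (forall t, count_mem t s = lam_len k t) ->
  perm_eq s [seq reshape_offset (nu_part k) p | p <- iota 0 (kron_size k)].
Proof.
move=> H; apply: perm_eq_count => t; rewrite H.
rewrite -(sumn_partition (nu_part_partition k)) count_reshape_offset count_map.
rewrite count_sum sum_iota.
under eq_bigr => j _ do rewrite /= (conj_len_lt (lam_len_noninc k) (lam_len_gt0 k)).
rewrite sum_ltn; apply/esym/minn_idPr.
exact: noninc_leq (lam_len_noninc k) _ _ (leq0n t).
Qed.

Lemma kronecker_ge k :
  (2 ^ #|hexagons k|)%:R <= kronecker (kron_size k) (lam_part k) (lam_part k) (nu_part k).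
Proof.
rewrite -card_powerset.
apply: (@kronecker_ge_card _ _ _ _ (3 * k) _ _ (fun S => pyramid k (mem_nat S))).
- exact: lam_part_partition.
- exact: lam_part_partition.
- exact: nu_part_partition.
- by move=> S; apply: uniq_pyramid.
- by move=> S; apply: perm_rows => t; apply: pyramid_count1.
- by move=> S; apply: perm_rows => t; apply: pyramid_count2.
- by move=> S; apply: perm_cols => t; apply: pyramid_count3.
- exact: pyramid_inj.
- by rewrite card_powerset expn_gt0.
- by move=> S x; apply: pyramid_max.
- by move=> S x; apply: pyramid_min.
Qed.

(** * Growth of the size with [k] *)

Lemma leq_sum_widen m m' (F : nat -> nat) : (m <= m')%N ->
  (\sum_(i < m) F i <= \sum_(i < m') F i)%N.
Proof.
move=> le; rewrite -!(big_mkord xpredT F) [leqRHS](big_cat_nat (n := m)) //=.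
exact: leq_addr.
Qed.

Lemma lam_len_mono k t : (lam_len k t <= lam_len k.+1 t)%N.
Proof.
apply: leq_add.
  apply: leq_trans (_ : \sum_(j < 3 * k) (3 * k.+1 - t - j) <= _)%N.
    by apply: leq_sum => j _; lia.
  by apply: (leq_sum_widen (fun j => 3 * k.+1 - t - j)%N); lia.
rewrite /layer_len big_ord_recr; apply: leq_trans (leq_addr _ _).
by apply: leq_sum => j _; have := ltn_ord j; rewrite /=; lia.
Qed.

Lemma kron_size_lt k : (kron_size k < kron_size k.+1)%N.
Proof.
apply: leq_trans (_ : \sum_(t < (3 * k).+1) lam_len k.+1 t <= _)%N; last first.
  by apply: leq_sum_widen; lia.
rewrite big_ord_recr /= -addn1; apply: leq_add; last by rewrite lam_len_gt0; lia.
by apply: leq_sum => t _; apply: lam_len_mono.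
Qed.

(** There are [3 * k] rows of length at most [9 * k ^ 2 + k], and [27 * k ^ 3 + 3 * k ^ 2] is at
    most [64 * k ^ 3]. *)
Lemma kron_size_le k : (kron_size k <= (4 * k) ^ 3)%N.
Proof.
have : (kron_size k <= \sum_(t < 3 * k) (3 * k * (3 * k) + k))%N.
  apply: leq_sum => t _; apply: leq_add.
    apply: leq_trans (_ : \sum_(j < 3 * k) (3 * k) <= _)%N; last first.
      by rewrite sum_nat_const card_ord.
    by apply: leq_sum => j _; lia.
  apply: leq_trans (_ : \sum_(j < k) 1 <= _)%N; last by rewrite sum1_card card_ord.
  by apply: leq_sum => j _; lia.
rewrite sum_nat_const card_ord => H; apply: leq_trans H _.
by rewrite expnMn !expnS expn0; case: k => // k; nia.
Qed.

(* [vk] and [vi] are the de Bruijn indices of the index of the partition and of *)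
(* the index of the part.                                                       *)
Definition lam_recipe (vk vi : nat) : recipe :=
  RAdd
    (RSum (RMul (RConst 3) (RVar vk))
       (RSub (RSub (RMul (RConst 3) (RVar vk.+1)) (RVar vi.+1)) (RVar 0)))
    (RSum (RVar vk)
       (RSub (RConst 1)
          (RSub (RAdd (RVar vi.+1) (RConst 1))
             (RMul (RConst 3) (RSub (RVar vk.+1) (RVar 0)))))).

Lemma reval_lam_recipe env vk vi :
  reval env (lam_recipe vk vi) = lam_len (nth 0%N env vk) (nth 0%N env vi).
Proof.
rewrite /lam_len /layer_len /=; congr (_ + _)%N.
by apply: eq_bigr => j _; rewrite addn1.
Qed.

Lemma explicit_lam : explicit_family lam_part.
Proof.
exists (lam_recipe 0 1) => k i.
by rewrite reval_lam_recipe (nth_part (lam_len_gt0 k)).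
Qed.

Lemma explicit_nu : explicit_family nu_part.
Proof.
(* Inside the sum the environment is [t], [k], [i], and the summand is the indicator of
   [i < lam_len k t]. *)
exists (RSum (RMul (RConst 3) (RVar 0))
  (RSub (RConst 1) (RSub (RAdd (RVar 2) (RConst 1)) (lam_recipe 1 0)))) => k i.
rewrite (nth_conj_part (lam_len_noninc k) (lam_len_gt0 k)).
transitivity (\sum_(t < 3 * k)
    (1 - (i + 1 - reval [:: (t : nat); k; i] (lam_recipe 1 0))))%N; last by [].
by apply: eq_bigr => t _; rewrite reval_lam_recipe /=; lia.
Qed.

Section Growth.

Variable R : realType.

Lemma powR_kron_size k :
  ((kron_size k)%:R : R) `^ (2%:R / 3%:R) <= ((4 * k) ^ 2)%:R.
Proof.
have -> : ((4 * k) ^ 2)%:R = ((4 * k) ^ 3)%:R `^ (2%:R / 3%:R) :> R.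
  rewrite !natrX -!powR_mulrn ?ler0n // -powRrM; congr (_ `^ _).
  by rewrite mulrCA mulfV ?mulr1 // pnatr_eq0.
by apply: ge0_ler_powR; rewrite ?nnegrE ?divr_ge0 ?ler0n // ler_nat kron_size_le.
Qed.

Lemma expR_kron_size k :
  expR (ln 2 / 32%:R * (kron_size k)%:R `^ (2%:R / 3%:R)) <= (2 ^ #|hexagons k|)%:R :> R.
Proof.
have ln2 : 0 < ln 2 :> R by rewrite ln_gt0 // ltr1n.
have -> : (2 ^ #|hexagons k|)%:R = expR (ln 2 * #|hexagons k|%:R) :> R.
  by rewrite expRM_natr lnK ?natrX // posrE ltr0n.
(* The size to the power 2/3 is at most [16 * k ^ 2], and [k ^ 2] is at most twice the number of
   hexagons, whence the factor 32. *)
rewrite ler_expR -mulrA ler_pM2l // mulrC ler_pdivrMr ?ltr0n //.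
apply: le_trans (powR_kron_size k) _; rewrite -natrM ler_nat.
by have := card_hexagons k; rewrite expnMn; lia.
Qed.

End Growth.

Theorem theorem9p4 (R : realType) :
  exists (n : nat -> nat) (lam mu nu : nat -> seq nat),
    [/\ explicit_family lam, explicit_family mu & explicit_family nu] /\
    (forall k : nat, (n k < n k.+1)%N) /\
    (forall k : nat, [/\ is_partition (n k) (lam k),
       is_partition (n k) (mu k) & is_partition (n k) (nu k)]) /\
    exists c : R, 0 < c /\
      forall k : nat, exists g : nat,
        kronecker (n k) (lam k) (mu k) (nu k) = g%:R /\
        expR (c * (n k)%:R `^ (2%:R / 3%:R)) <= g%:R.
Proof.
exists kron_size, lam_part, lam_part, nu_part.
split; first by split; [exact: explicit_lam | exact: explicit_lam | exact: explicit_nu].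
split; first exact: kron_size_lt.
split.
  move=> k; split; [exact: lam_part_partition | exact: lam_part_partition |].
  exact: nu_part_partition.
exists (ln 2 / 32%:R); split; first by rewrite divr_gt0 ?ltr0n // ln_gt0 // ltr1n.
move=> k; have [g Eg] := kronecker_nat (kron_size k) (lam_part k) (lam_part k) (nu_part k).
exists g; split=> //; apply: le_trans (expR_kron_size R k) _.
by have := kronecker_ge k; rewrite Eg !ler_nat.
Qed.
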